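(* Let $X$ be a separable Banach space and let $Y$ be a Banach space. If $G\in L(X,Y)$ is lush, then the set $$\Omega=\{y^*\in\operatorname{ext}B_{Y^*}: G^*y^*\in\operatorname{Spear}(X^* )\}$$ is a dense $G_\delta$ subset of $(\operatorname{ext}B_{Y^*},w^* )$. In other words, if $G$ is lush, there exists a dense $G_\delta$ subset $\Omega$ of $(\operatorname{ext}B_{Y^*},w^* )$ such that $$B_X=\overline{\operatorname{aconv}}\bigl(\{x\in S_X:\operatorname{Re}y^*(Gx)=1\}\bigr)$$ for every $y^*\in\Omega$.
   Context: Scalars are $\mathbb{K}=\mathbb{R}$ or $\mathbb{C}$; $\mathbb{T}=\{\omega\in\mathbb{K}:|\omega|=1\}$; $B_X$, $S_X$ are the closed unit ball and unit sphere; $\operatorname{ext}$ denotes the set of extreme points; $\operatorname{aconv}(F)=\operatorname{conv}(\mathbb{T}F)$. $\operatorname{Spear}(Z)$ is the set of spear vectors of a Banach space $Z$: those $z\in S_Z$ with $\sup_{\omega\in\mathbb{T}}\|z+\omega x\|=1+\|x\|$ for every $x\in Z$. A norm-one $G\in L(X,Y)$ is lush if for every $x_0\in B_X$, $\varepsilon>0$ and $y\in S_Y$ there is $F\subset B_X$ with $\operatorname{conv}(F)\subset\{x\in B_X:\|Gx+y\|>2-\varepsilon\}$ and $\operatorname{dist}(x_0,\operatorname{aconv}(F))<\varepsilon$. *)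

(* Defs.v *)
From HB Require Import structures.
From mathcomp Require Import all_boot all_order all_algebra.
From mathcomp Require Import complex.
From mathcomp Require Import all_classical all_reals.
From mathcomp Require Import convex topology normedtype borel_hierarchy.

Set Implicit Arguments.
Unset Strict Implicit.
Unset Printing Implicit Defensive.

Import Order.TTheory GRing.Theory Num.Theory.
Import numFieldNormedType.Exports.

Local Open Scope classical_set_scope.
Local Open Scope ring_scope.

Variant scalar_kind := RealScalars | ComplexScalars.

Definition scalar_field (R : realType) (k : scalar_kind) : numFieldType :=
  match k with RealScalars => R | ComplexScalars => R[i] end.

Definition scalar_re (R : realType) (k : scalar_kind) : scalar_field R k -> R :=
  match k return scalar_field R k -> R with
  | RealScalars => fun x => x
  | ComplexScalars => fun z => complex.Re z
  end.

(* Norms take their values in the scalar field. In [R[i]] the order is the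
   partial order in which [x <= y] forces [y - x] to be real, so that suprema
   and infima of sets of norms are the ones computed in [R]. *)
Section Geometry.
Variables (K : numFieldType) (Z : normedModType K).
Implicit Types (A F : set Z) (z x : Z).

Definition unit_scalars : set K := [set w | `|w| = 1].

Definition unit_ball : set Z := [set x | `|x| <= 1].

Definition unit_sphere : set Z := [set x | `|x| = 1].

Definition extreme_points A : set Z :=
  [set x | A x /\ forall y z (t : K), A y -> A z -> 0 < t < 1 ->
                    x = t *: y + (1 - t) *: z -> y = x /\ z = x].

Definition conv A : set Z := smallest (@convex_set K Z) A.

Definition aconv A : set Z := conv [set w *: x | w in unit_scalars & x in A].

(* No [d] satisfies this when [A] is empty, i.e., when the distance is +oo. *)
Definition is_dist x A (d : K) : Prop := infimums [set `|x - a| | a in A] d.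

Definition spear : set Z :=
  [set z | unit_sphere z /\
     forall x, supremums [set `|z + w *: x| | w in unit_scalars] (1 + `|x|)].

End Geometry.
Arguments unit_ball {K} Z.
Arguments unit_sphere {K} Z.
Arguments spear {K} Z.

Definition separable_space (T : topologicalType) : Prop :=
  exists2 D : set T, countable D & dense D.

Section BoundedOperators.
Variables (K : numFieldType) (X Y : normedModType K).

Definition is_bounded_op : {pred X -> Y} :=
  fun f => `[< linear f /\ continuous f >].

Record bounded_op :=
  BoundedOp { bounded_op_fun :> X -> Y ; _ : bounded_op_fun \in is_bounded_op }.

HB.instance Definition _ := [isSub for bounded_op_fun].
HB.instance Definition _ := [Choice of bounded_op by <:].

Lemma is_bounded_op_submod : submod_closed is_bounded_op.
Proof.
split=> [|a f g /asboolP[lf cf] /asboolP[lg cg]]; apply/asboolP; split.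
- by move=> b x y; rewrite /= scaler0 addr0.
- exact: cst_continuous.
- move=> b x y; rewrite !fctE lf lg !scalerDr addrACA !scalerA.
  by rewrite [a * b]mulrC.
- move=> x; apply: continuousD; last exact: cg.
  by apply: (@continuousZl_tmp K Y X f a); exact: cf.
Qed.

HB.instance Definition _ :=
  GRing.isSubmodClosed.Build K (X -> Y) is_bounded_op is_bounded_op_submod.
HB.instance Definition _ :=
  GRing.SubChoice_isSubLmodule.Build K (X -> Y) is_bounded_op bounded_op
    is_bounded_op_submod.

Lemma bounded_op_linear (f : bounded_op) : linear f.
Proof. by case: f => f /= /asboolP[]. Qed.

HB.instance Definition _ (f : bounded_op) :=
  GRing.isLinear.Build K X Y *:%R (bounded_op_fun f) (bounded_op_linear f).

Lemma bounded_op_continuous (f : bounded_op) : continuous f.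
Proof. by case: f => f /= /asboolP[]. Qed.

Definition op_norm (f : bounded_op) : K :=
  supremum 0 [set `|f x| | x in unit_ball X].

End BoundedOperators.

Section OperatorNorm.
Variables (R : realType) (k : scalar_kind).
Local Notation K := (scalar_field R k).

Lemma scalar_supremums (A : set K) : has_sup A -> supremums A !=set0.
Proof.
case: k A => /= A.
  move=> supA; exists (sup A); split; first exact: sup_upper_bound.
  by move=> y uby; apply: ge_sup => //; case: supA.
case=> -[a Aa] [b ub].
have ImA x : A x -> complex.Im x = complex.Im b.
  by move/ub; rewrite lecE => /andP[/eqP].
have supA : has_sup (@complex.Re R @` A).
  split; first by exists (complex.Re a), a.
  exists (complex.Re b) => _ [x Ax <-].
  by have := ub _ Ax; rewrite lecE => /andP[].
exists (Complex (sup (@complex.Re R @` A)) (complex.Im b)); split.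
  move=> x Ax; rewrite lecE; apply/andP; split; first by rewrite (ImA _ Ax).
  by apply: sup_upper_bound => //; exists x.
move=> y uby; rewrite lecE/=.
have := uby _ Aa; rewrite lecE (ImA _ Aa) => /andP[-> _] /=.
apply: ge_sup; first by case: supA.
by move=> _ [x Ax <-]; have := uby _ Ax; rewrite lecE => /andP[].
Qed.

Variables X Y : normedModType K.
Implicit Types f g : bounded_op X Y.

Lemma op_norm_supremum f :
  supremums [set `|f x| | x in unit_ball X] (op_norm f).
Proof.
have supf : has_sup [set `|f x| | x in unit_ball X].
  split; first by exists `|f 0|, 0 => //=; rewrite /unit_ball/= normr0.
  have /linear_boundedP/pinfty_ex_gt0[r r0 fr] :=
    continuous_linear_bounded 0 (@bounded_op_continuous _ _ _ f 0).
  exists r => _ [x x1 <-]; apply: (le_trans (fr x)).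
  by rewrite ger_pMr.
have [s sP] := scalar_supremums supf.
rewrite /op_norm /supremum; case: ifPn => [/eqP A0|_].
  by have := supf.1; rewrite A0 => -[].
by apply: (xgetPex 0); exists s.
Qed.

Lemma op_norm_ub f x : `|x| <= 1 -> `|f x| <= op_norm f.
Proof. by move=> x1; apply: (op_norm_supremum f).1; exists x. Qed.

Lemma op_norm_le f r :
  (forall x, `|x| <= 1 -> `|f x| <= r) -> op_norm f <= r.
Proof.
by move=> fr; apply: (op_norm_supremum f).2 => _ [x x1 <-]; exact: fr.
Qed.

Lemma op_norm_ge0 f : 0 <= op_norm f.
Proof.
by rewrite (le_trans _ (@op_norm_ub f 0 _))// normr0.
Qed.

Lemma op_normD f g : op_norm (f + g) <= op_norm f + op_norm g.
Proof.
apply: op_norm_le => x x1; apply: (le_trans (ler_normD _ _)).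
by apply: lerD; exact: op_norm_ub.
Qed.

Lemma op_normZ (a : K) f : op_norm (a *: f) = `|a| * op_norm f.
Proof.
have le_normZ (b : K) g : op_norm (b *: g) <= `|b| * op_norm g.
  apply: op_norm_le => x x1.
  by rewrite [X in `|X|](_ : _ = b *: g x)// normrZ ler_wpM2l// op_norm_ub.
apply/eqP; rewrite eq_le le_normZ/=.
have [->|a0] := eqVneq a 0; first by rewrite normr0 mul0r op_norm_ge0.
rewrite -ler_pdivlMl ?normr_gt0// -normfV.
by rewrite -{1}[f](scalerK a0) le_normZ.
Qed.

Lemma op_norm_eq0 f : op_norm f = 0 -> f = 0.
Proof.
move=> f0; apply/val_inj/funext => x /=.
have [->|x0] := eqVneq x 0; first by rewrite linear0.
have nx0 : 0 < `|x| by rewrite normr_gt0.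
have : `|f (`|x|^-1 *: x)| <= 0.
  rewrite -f0 op_norm_ub// normrZ normfV normr_id mulVf//.
  by rewrite normr_eq0.
rewrite normr_le0 linearZ scaler_eq0 invr_eq0 normr_eq0 (negbTE x0)/=.
by move/eqP.
Qed.

HB.instance Definition _ :=
  Lmodule_isNormed.Build K (bounded_op X Y) op_normD op_normZ op_norm_eq0.

End OperatorNorm.

Section Dual.
Variables (R : realType) (k : scalar_kind).
Local Notation K := (scalar_field R k).

Definition dual (X : normedModType K) : normedModType K := bounded_op X K^o.

Lemma adjoint_subproof (X Y : normedModType K) (G : bounded_op X Y)
  (f : dual Y) : (f : bounded_op Y K^o) \o G \in @is_bounded_op K X K^o.
Proof.
apply/asboolP; split=> [a x y|x] /=; first by rewrite !linearP.
by apply: continuous_comp; exact: bounded_op_continuous.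
Qed.

Definition adjoint (X Y : normedModType K) (G : bounded_op X Y) (f : dual Y) :
  dual X := BoundedOp (adjoint_subproof G f).

(* The topology of pointwise convergence, i.e., the coarsest topology making all
   evaluations [f |-> f y] continuous. *)
Definition weak_star (Y : normedModType K) : topologicalType :=
  initial_topology (fun f : bounded_op Y K^o => (f : {ptws Y -> K^o})).

Definition ext_dual (Y : normedModType K) : topologicalType :=
  set_type (extreme_points (unit_ball (dual Y)) : set (weak_star Y)).

(* [0 < e] in the scalar field forces [e] to be a positive real number. *)
Definition lush (X Y : normedModType K) (G : bounded_op X Y) : Prop :=
  `|G| = 1 /\
  forall (x0 : X) (e : K) (y : Y), unit_ball X x0 -> 0 < e -> unit_sphere Y y ->
  exists F : set X,
    [/\ F `<=` unit_ball X,
        conv F `<=` [set x | unit_ball X x /\ 2 - e < `|G x + y|] &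
        exists2 d, is_dist x0 (aconv F) d & d < e].

End Dual.

(* Main.v *)
(* A functional x* of norm at most 1 is a spear iff the ball of X is the closed
   absolutely convex hull of every slice {Re x* > 1 - e}: one direction is a
   direct estimate, the other is Hahn-Banach separation. By separability this is,
   for x* = G* y*, a countable family of weak-star open conditions on y*, whence
   the G_delta part.

   For density, lushness shows that each of the conditions holds on a whole slice
   {Re y* > |y'| - r} of the dual ball, for y' arbitrarily close to a given y. By
   the Baire argument in Y, all y* in the ball with Re y*(l) = |l| satisfy all
   conditions, for l arbitrarily close to a given z. The functionals norming l
   form a face, which contains an extreme point; and slices form a base of
   neighbourhoods of an extreme point in the weak-star topology (Choquet).

   Compactness is never used: faces and weak-star compact convex sets are replaced
   by their support functions, i.e., sublinear functionals on the underlying real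
   space, and functionals by their real parts.

   Finally, completeness of X upgrades slices to the face {x* = 1}: points of a
   slice can be moved a little to lie in a much smaller slice, and so on. *)

From HB Require Import structures.
Require Import Defs.
From mathcomp Require Import all_boot all_order all_algebra.
From mathcomp Require Import complex.
From mathcomp Require Import all_classical all_reals.
From mathcomp Require Import convex topology normedtype borel_hierarchy.
From mathcomp Require Import interval_inference ring lra.
Set Implicit Arguments.
Unset Strict Implicit.
Unset Printing Implicit Defensive.
Import Order.TTheory GRing.Theory Num.Theory.
Import numFieldNormedType.Exports.
Local Open Scope classical_set_scope.
Local Open Scope ring_scope.

(** * Sublinear functionals and extreme points *)

Section Sublinear.
Context {R : realType} {V : lmodType R}.
Implicit Types (p q N g h : V -> R) (x y z : V) (t : R).

(** Homogeneity is asked as an inequality, which infima yield directly; [sublinearZ] recovers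
    equality by rescaling with [t^-1]. *)
Definition sublinear p :=
  (forall x y, p (x + y) <= p x + p y) /\
  (forall t x, 0 < t -> p (t *: x) <= t * p x).

Lemma sublinearZ p t x : sublinear p -> 0 < t -> p (t *: x) = t * p x.
Proof.
move=> [_ pZ] t0; apply/eqP; rewrite eq_le pZ//=.
have := pZ t^-1 (t *: x); rewrite invr_gt0 scalerA mulVf ?gt_eqF// scale1r.
by move=> /(_ t0); rewrite mulrC ler_pdivlMr// mulrC.
Qed.

Lemma sublinear0 p : sublinear p -> p 0 = 0.
Proof.
move=> sp; have := @sublinearZ p 2 0 sp; rewrite scaler0 => /(_ (ltr0Sn _ _)).
by move=> ?; lra.
Qed.

Lemma sublinearN p x : sublinear p -> - p (- x) <= p x.
Proof.
move=> sp; have := sp.1 x (- x); rewrite subrr sublinear0// => ?; lra.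
Qed.

Lemma scalarf0 g : scalar g -> g 0 = 0.
Proof.
by move=> lg; have := lg 1 0 0; rewrite scaler0 addr0 => ?; lra.
Qed.

Lemma scalarfZ g t x : scalar g -> g (t *: x) = t * g x.
Proof. by move=> lg; have := lg t x 0; rewrite scalarf0// !addr0. Qed.

Lemma scalarfD g x y : scalar g -> g (x + y) = g x + g y.
Proof. by move=> lg; have := lg 1 x y; rewrite scale1r mul1r. Qed.

Lemma scalarfN g x : scalar g -> g (- x) = - g x.
Proof. by move=> lg; rewrite -scaleN1r scalarfZ// mulN1r. Qed.

Lemma scalar_le_eq g h : scalar g -> scalar h ->
  (forall x, g x <= h x) -> g = h.
Proof.
move=> lg lh gh; apply/funext => x; apply/eqP; rewrite eq_le gh/=.
by have := gh (- x); rewrite !scalarfN// lerN2.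
Qed.

Lemma sublinear_inf (S : V -> set R) :
  (forall x, has_inf (S x)) ->
  (forall x y a b, S x a -> S y b -> exists2 c, S (x + y) c & c <= a + b) ->
  (forall t x a, 0 < t -> S x a -> exists2 c, S (t *: x) c & c <= t * a) ->
  sublinear (fun x => inf (S x)).
Proof.
move=> infS SD SZ; split=> /= [x y|t x t0].
  rewrite -lerBlDr; apply: lb_le_inf; first by case: (infS x).
  move=> a Sa; rewrite lerBlDr -lerBlDl.
  apply: lb_le_inf; first by case: (infS y).
  move=> b Sb; rewrite lerBlDl; have [c Sc cab] := SD _ _ _ _ Sa Sb.
  by apply: le_trans cab; apply: ge_inf => //; case: (infS (x + y)).
rewrite -ler_pdivrMl//; apply: lb_le_inf; first by case: (infS x).
move=> a Sa; rewrite ler_pdivrMl//.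
have [c Sc ca] := SZ _ _ _ t0 Sa.
by apply: le_trans ca; apply: ge_inf => //; case: (infS (t *: x)).
Qed.

(* For [c <= p y], the support function of [[set g | g <= p /\ c <= g y]]. *)
Definition cap_support p y c x : R :=
  inf [set p (x + t *: y) - t * c | t in [set t | 0 <= t]].

Lemma cap_support_has_inf p y c x : sublinear p -> c <= p y ->
  has_inf [set p (x + t *: y) - t * c | t in [set t | 0 <= t]].
Proof.
move=> sp cp; split; first by exists (p (x + 0 *: y) - 0 * c), 0 => /=.
exists (- p (- x)) => _ [t /= t0 <-].
have [->|t_neq0] := eqVneq t 0.
  by rewrite scale0r mul0r addr0 subr0; exact: sublinearN.
have {t_neq0}t0 : 0 < t by rewrite lt_neqAle eq_sym t_neq0.
have : t * c <= p (t *: y) by rewrite (sublinearZ _ sp t0) ler_pM2l.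
by have := sp.1 (x + t *: y) (- x); rewrite addrAC subrr add0r => ? ?; lra.
Qed.

Lemma cap_support_sublinear p y c : sublinear p -> c <= p y ->
  sublinear (cap_support p y c).
Proof.
move=> sp cp; apply: sublinear_inf.
- by move=> x; exact: cap_support_has_inf.
- move=> x x' _ _ [t /= t0 <-] [t' /= t'0 <-].
  exists (p (x + x' + (t + t') *: y) - (t + t') * c).
    by exists (t + t') => //=; rewrite addr_ge0.
  have := sp.1 (x + t *: y) (x' + t' *: y).
  by rewrite addrACA -scalerDl => ?; lra.
- move=> s x _ s0 [t /= t0 <-].
  exists (p (s *: x + (s * t) *: y) - (s * t) * c).
    by exists (s * t) => //=; rewrite mulr_ge0// ltW.
  by rewrite -scalerA -scalerDr sublinearZ// mulrBr mulrA.
Qed.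

Lemma cap_support_ge p y c x t : sublinear p -> c <= p y -> 0 <= t ->
  cap_support p y c x <= p (x + t *: y) - t * c.
Proof.
move=> sp cp t0; apply: ge_inf; last by exists t.
by case: (cap_support_has_inf x sp cp).
Qed.

Lemma cap_support_le p y c x : sublinear p -> c <= p y ->
  cap_support p y c x <= p x.
Proof.
move=> sp cp; apply: le_trans (cap_support_ge x sp cp (lexx 0)) _.
by rewrite scale0r mul0r addr0 subr0.
Qed.

(** With [cap_support_le] and [cap_support_attained], this identifies the linear functionals below
    the cap as those [h <= p] with [c <= h y]. *)
Lemma le_cap_support p y c h : sublinear p -> c <= p y -> scalar h ->
  (forall x, h x <= p x) -> c <= h y ->
  forall x, h x <= cap_support p y c x.
Proof.
move=> sp cp lh hp ch x; apply: lb_le_inf.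
  by case: (cap_support_has_inf x sp cp).
move=> _ [t /= t0 <-]; have := hp (x + t *: y); rewrite scalarfD// scalarfZ//.
by have := ler_wpM2l t0 ch => ? ?; lra.
Qed.

Lemma cap_support_attained p y c h : sublinear p -> c <= p y -> scalar h ->
  h (- y) <= cap_support p y c (- y) -> c <= h y.
Proof.
move=> sp cp lh hp; have := cap_support_ge (- y) sp cp ler01.
by rewrite scale1r addNr sublinear0// => ?; move: hp; rewrite scalarfN//; lra.
Qed.

Definition is_face N p := forall g h t, scalar g -> scalar h ->
  (forall x, g x <= N x) -> (forall x, h x <= N x) -> 0 < t < 1 ->
  (forall x, t * g x + (1 - t) * h x <= p x) ->
  (forall x, g x <= p x) /\ (forall x, h x <= p x).

(** For [N] the norm, these are the real parts of the extreme points of the dual ball, by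
    [extreme_pointsP]. *)
Definition extremal N g := [/\ scalar g, forall x, g x <= N x &
  forall g1 g2 t, scalar g1 -> scalar g2 ->
  (forall x, g1 x <= N x) -> (forall x, g2 x <= N x) -> 0 < t < 1 ->
  (forall x, g x = t * g1 x + (1 - t) * g2 x) -> g1 = g /\ g2 = g].

(** Maximizing evaluation at [y] over a face cuts out a smaller face: [g y] and [h y] are at most
    [p y], so an average reaching [p y] forces equality in both. *)
Lemma is_face_cap_support N p y : sublinear p -> is_face N p ->
  is_face N (cap_support p y (p y)).
Proof.
move=> sp faceNp g h t lg lh gN hN t01 ghp.
have [gp hp] : (forall x, g x <= p x) /\ (forall x, h x <= p x).
  apply: faceNp t01 _ => // x; apply: le_trans (ghp x) _.
  exact: cap_support_le.
pose k x := t * g x + (1 - t) * h x.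
have lk : scalar k by move=> a u v; rewrite /k lg lh; lra.
have := cap_support_attained sp (lexx _) lk (ghp _); rewrite /k => pk.
have t0 : 0 < t by lra.
have t1 : 0 < 1 - t by lra.
have : t * g y <= t * p y by rewrite ler_pM2l.
have : (1 - t) * h y <= (1 - t) * p y by rewrite ler_pM2l.
move=> hy gy.
split; apply: le_cap_support => //.
- by rewrite -(ler_pM2l t0); lra.
- by rewrite -(ler_pM2l t1); lra.
Qed.

(** The term [t = 1] of the cap gives [p x + p y <= p (x + y)], so a [p] fixed by all caps is
    additive. *)
Lemma sublinear_scalar p : sublinear p ->
  (forall y, p = cap_support p y (p y)) -> scalar p.
Proof.
move=> sp pE.
have pD x y : p (x + y) = p x + p y.
  apply/eqP; rewrite eq_le sp.1/=.
  have := cap_support_ge x sp (lexx (p y)) ler01.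
  by rewrite -pE scale1r mul1r lerBrDr.
have pN x : p (- x) = - p x.
  by have := pD x (- x); rewrite subrr sublinear0// => ?; lra.
move=> a x y; rewrite pD; congr (_ + _).
case: (ltrgtP a 0) => [a0|a0|->].
- by rewrite -[a]opprK scaleNr pN sublinearZ ?oppr_gt0// [RHS]mulNr.
- exact: (sublinearZ _ sp a0).
- by rewrite scale0r mul0r sublinear0.
Qed.

(* Zorn's lemma on the sublinear [p] for which [[set g | g <= p]] is a face of
   [[set g | g <= N]]; a minimal one equals its own [cap_support], hence is
   linear. This covers both Hahn-Banach and Krein-Milman. *)
Lemma exists_extremal N x0 : sublinear N ->
  exists2 g, extremal N g & g x0 = N x0.
Proof.
move=> sN; pose N0 := cap_support N x0 (N x0).
pose P p := [/\ sublinear p, is_face N p & forall x, p x <= N0 x].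
have PN0 : P N0.
  split=> //; first exact: cap_support_sublinear.
  by apply: is_face_cap_support.
pose T := {p | P p}.
(* The order is reversed: maximal elements for [Zorn] are minimal functionals. *)
pose rel (p q : T) := `[< forall x, sval q x <= sval p x >].
have PN p x : P p -> - N (- x) <= p x.
  move=> [sp _ pN]; apply: le_trans (sublinearN x sp); rewrite lerN2.
  by apply: (le_trans (pN _)); exact: cap_support_le.
have [|||A Atot|[p Pp] pmin] := @Zorn T rel.
- by move=> p; apply/asboolP.
- move=> p q r /asboolP pq /asboolP qr; apply/asboolP => x.
  exact: le_trans (qr x) (pq x).
- move=> [p Pp] [q Pq] /asboolP/= pq /asboolP/= qp; apply: eq_exist.
  by apply/funext => x; apply/eqP; rewrite eq_le pq qp.
- have [[p0 Ap0]|A0] := pselect (A !=set0); last first.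
    by exists (exist _ _ PN0) => s As; exfalso; apply: A0; exists s.
  pose S x := [set sval p x | p in A].
  have infS x : has_inf (S x).
    split; first by exists (sval p0 x), p0.
    by exists (- N (- x)) => _ [p _ <-]; apply: PN; exact: svalP.
  have le_inf (p : T) x : A p -> inf (S x) <= sval p x.
    by move=> Ap; apply: ge_inf; [case: (infS x)|exists p].
  have Pinf : P (fun x => inf (S x)).
    split.
    + apply: sublinear_inf => //.
        move=> x y _ _ [p Ap <-] [q Aq <-].
        have [/asboolP pq|/asboolP qp] := Atot _ _ Ap Aq.
          exists (sval q (x + y)); first by exists q.
          have [[qD _] _ _] := svalP q.
          by apply: (le_trans (qD _ _)); rewrite lerD2r.
        exists (sval p (x + y)); first by exists p.
        have [[pD _] _ _] := svalP p.
        by apply: (le_trans (pD _ _)); rewrite lerD2l.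
      move=> t x _ t0 [p Ap <-]; exists (sval p (t *: x)); first by exists p.
      by have [[_ pZ] _ _] := svalP p; exact: pZ.
    + move=> g h t lg lh gN hN t01 ghp.
      have ghA (p : T) : A p ->
          (forall x, g x <= sval p x) /\ forall x, h x <= sval p x.
        move=> Ap; have [_ fp _] := svalP p; apply: fp t01 _ => // x.
        by apply: (le_trans (ghp x)); exact: le_inf.
      split=> x; apply: lb_le_inf; try by case: (infS x).
      * by move=> _ [p Ap <-]; exact: (ghA p Ap).1.
      * by move=> _ [p Ap <-]; exact: (ghA p Ap).2.
    + move=> x; apply: (le_trans (le_inf p0 x Ap0)).
      by have [_ _ p0N0] := svalP p0; exact: p0N0.
  by exists (exist _ _ Pinf) => p Ap; apply/asboolP => x /=; exact: le_inf.
have [sp fp pN0] := Pp.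
have lp : scalar p.
  apply: sublinear_scalar => // y.
  have Py : P (cap_support p y (p y)).
    split; [exact: cap_support_sublinear|exact: is_face_cap_support|].
    by move=> x; apply: le_trans (pN0 x); exact: cap_support_le.
  apply: esym; apply: (congr1 sval (pmin (exist _ _ Py) _)).
  by apply/asboolP => x /=; exact: cap_support_le.
have pN x : p x <= N x.
  by apply: (le_trans (pN0 x)); exact: cap_support_le.
exists p.
  split=> // g1 g2 t l1 l2 g1N g2N t01 pE.
  have [g1p g2p] : (forall x, g1 x <= p x) /\ (forall x, g2 x <= p x).
    by apply: fp t01 _ => // x; rewrite -pE.
  by split; exact: scalar_le_eq.
(* At [- x0] the inequality [p <= N0] yields [N x0 <= p x0]. *)
by apply/eqP; rewrite eq_le pN/=; exact: cap_support_attained (pN0 _).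
Qed.

End Sublinear.

(** * Slices at an extremal functional *)

Section ExtremalSlices.
Context {R : realType} {V : lmodType R}.
Implicit Types (p q N g h : V -> R) (x y z : V) (t : R).

(* Hahn-Banach on [R * R * V] yields [lambda], [mu >= 0] of sum [1] and linear
   [g <= lambda * s], [h <= mu * t] with [p = g + h]. *)
Lemma extremal_le_max N p (s t : V -> R) : extremal N p ->
  sublinear s -> sublinear t ->
  (forall x, s x <= N x) -> (forall x, t x <= N x) ->
  (forall x, p x <= Num.max (s x) (t x)) ->
  (forall x, p x <= s x) \/ (forall x, p x <= t x).
Proof.
move=> [lp pN extp] ss st sN tN pst.
pose W : lmodType R := (R^o * R^o * V)%type.
(* In [w = (a, b, y)], [a] and [b] shift the two branches and [y] translates the argument of [s]; at
   [w = 0] all values are nonnegative by [pst]. *)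
pose f (w : W) x : R :=
  Num.max (s (w.2 + x) + w.1.1) (t x + w.1.2) - p x.
pose S (w : W) := range (f w).
have infS w : has_inf (S w).
  split; first by exists (f w 0), 0.
  exists (Num.min (w.1.1 - s (- w.2)) w.1.2) => _ [x _ <-].
  have := ss.1 (w.2 + x) (- w.2); rewrite addrAC subrr add0r => sx.
  have := pst x; rewrite le_max => /orP[psx|ptx].
    rewrite ge_min; apply/orP; left; rewrite /f lerBrDr le_max.
    by apply/orP; left; lra.
  rewrite ge_min; apply/orP; right; rewrite /f lerBrDr le_max.
  by apply/orP; right; lra.
have sM : sublinear (fun w => inf (S w)).
  apply: sublinear_inf => //.
  - move=> w w' _ _ [x _ <-] [x' _ <-].
    exists (f (w + w') (x + x')); first by exists (x + x').
    rewrite /f (scalarfD _ _ lp) [leRHS]addrACA -opprD lerD2r.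
    rewrite (_ : (w + w').2 + _ = (w.2 + x) + (w'.2 + x')); last exact: addrACA.
    rewrite (_ : (w + w').1.1 = w.1.1 + w'.1.1)//.
    rewrite (_ : (w + w').1.2 = w.1.2 + w'.1.2)//.
    rewrite ge_max; apply/andP; split.
      apply: (@le_trans _ _
        ((s (w.2 + x) + w.1.1) + (s (w'.2 + x') + w'.1.1))).
        by have := ss.1 (w.2 + x) (w'.2 + x'); lra.
      by rewrite lerD// le_max lexx.
    apply: (@le_trans _ _ ((t x + w.1.2) + (t x' + w'.1.2))).
      by have := st.1 x x'; lra.
    by rewrite lerD// le_max lexx orbT.
  - move=> a w _ a0 [x _ <-].
    exists (f (a *: w) (a *: x)); first by exists (a *: x).
    rewrite /f (scalarfZ _ _ lp) (sublinearZ _ st a0).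
    rewrite (_ : (a *: w).2 + _ = a *: (w.2 + x)); last by rewrite scalerDr.
    rewrite (sublinearZ _ ss a0) mulrBr lerD2r.
    by rewrite (maxr_pMr _ _ (ltW a0)) !mulrDr.
have [L [lL LM _] _] := exists_extremal 0 sM.
have Lf w x : L w <= f w x.
  by apply: le_trans (LM w) _; apply: ge_inf; [case: (infS w)|exists x].
pose l := L (1, 0, 0); pose m := L (0, 1, 0); pose g y := L (0, 0, y).
have LE a b y : L (a, b, y) = a * l + b * m + g y.
  rewrite -!scalarfZ// -!scalarfD//; congr L; congr pair; last first.
    by rewrite /= !scaler0 !add0r.
  by congr pair; rewrite /= ?scaler0 ?addr0 ?add0r; apply/esym/mulr1.
have lg : scalar g.
  move=> a x y; rewrite /g -lL; congr L; congr pair; congr pair;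
  by rewrite /= scaler0 addr0.
have g0 : g 0 = 0 by exact: scalarf0.
have sum1 : l + m = 1.
  have := Lf (1, 1, 0) 0; have := Lf (-1, -1, 0) 0.
  rewrite !LE /f /= !addr0 (sublinear0 ss) (sublinear0 st) (scalarf0 lp) !maxxx.
  by rewrite g0; lra.
have l0 : 0 <= l.
  have := Lf (-1, 0, 0) 0.
  rewrite !LE /f /= !addr0 (sublinear0 ss) (sublinear0 st) (scalarf0 lp).
  by rewrite g0 max_r; lra.
have m0 : 0 <= m.
  have := Lf (0, -1, 0) 0.
  rewrite !LE /f /= !addr0 (sublinear0 ss) (sublinear0 st) (scalarf0 lp).
  by rewrite g0 max_l; lra.
(* At [x'] the chosen shifts make both branches vanish. Setting [x'] or [x] to [0] then splits [p]
   into [g <= l * s] and [p - g <= m * t]. *)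
have key x x' : g x - g x' + p x' <= l * s x + m * t x'.
  have := Lf (- s x, - t x', x - x') x'.
  rewrite LE /f /= subrK !subrr maxxx (scalarfD _ _ lg) (scalarfN _ lg).
  by lra.
have gs x : g x <= l * s x.
  have := key x 0; rewrite g0 (scalarf0 lp) (sublinear0 st); lra.
have hm x : p x - g x <= m * t x.
  have := key 0 x; rewrite g0 (sublinear0 ss); lra.
(* With weight [l = 0], the linear [g <= 0] vanishes and [p <= t]; the case [m = 0] is symmetric. *)
have [le0|ln0] := eqVneq l 0.
  right=> x; have m1 : m = 1 by lra.
  have gl x' : g x' <= 0 by have := gs x'; rewrite le0 mul0r.
  have := gl (- x); rewrite (scalarfN _ lg); have := hm x; rewrite m1.
  by have := gl x; lra.
have [me0|mn0] := eqVneq m 0.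
  left=> x; have l1 : l = 1 by lra.
  by have := hm x; have := gs x; rewrite me0 l1; lra.
have {l0 ln0}l0 : 0 < l by rewrite lt_neqAle eq_sym ln0.
have {m0 mn0}m0 : 0 < m by rewrite lt_neqAle eq_sym mn0.
(* Now [p = l * g1 + m * g2] is a proper convex combination, so extremality gives [g1 = p]. *)
pose g1 x := l^-1 * g x; pose g2 x := m^-1 * (p x - g x).
have g1s x : g1 x <= s x by rewrite ler_pdivrMl.
have g2t x : g2 x <= t x by rewrite ler_pdivrMl.
have [||||||<- _] := extp g1 g2 l.
- by move=> a x y; rewrite /g1 lg; lra.
- by move=> a x y; rewrite /g2 lg lp; lra.
- by move=> x; exact: le_trans (g1s x) (sN x).
- by move=> x; exact: le_trans (g2t x) (tN x).
- by lra.
- move=> x; have -> : 1 - l = m by lra.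
  by rewrite /g1 /g2 !mulVKf ?gt_eqF//; lra.
- by left.
Qed.

(* Choquet's lemma: slices are a neighbourhood base at an extreme point. *)
Lemma extremal_slice N p (s : seq V) (e : R) : sublinear N -> extremal N p ->
  0 < e -> exists z a, a < p z /\
    forall g, scalar g -> (forall x, g x <= N x) -> a < g z ->
    forall y, y \in s -> g y < p y + e.
Proof.
move=> sN extp e0.
(* All functionals violating some bound lie below a single [q] that does not dominate [p]; a [z]
   with [q z < p z] then gives the slice, with [a = q z]. *)
suff [sE|[q [sq qN npq qP]]] :
    (forall g, scalar g -> (forall x, g x <= N x) ->
       forall y, y \in s -> g y < p y + e) \/
    exists q, [/\ sublinear q, forall x, q x <= N x, ~ forall x, p x <= q x &
      forall g, scalar g -> (forall x, g x <= N x) ->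
      forall y, y \in s -> p y + e <= g y -> forall x, g x <= q x].
- exists 0, (-1); split; last by move=> g lg gN _; exact: sE.
  by case: extp => lp _ _; rewrite scalarf0//; lra.
- have /existsNP[z /negP] := npq; rewrite -ltNge => qz.
  exists z, (q z); split=> // g lg gN qgz y ys; rewrite ltNge; apply/negP => pg.
  by have := qP g lg gN y ys pg z; rewrite leNgt qgz.
elim: s => [|y s IH]; first by left.
have [lp pN _] := extp.
have [cN|Nc] := leP (p y + e) (N y); last first.
  have ygt g : (forall x, g x <= N x) -> g y < p y + e.
    by move=> gN; exact: le_lt_trans (gN y) Nc.
  case: IH => [IH|[q [sq qN npq qP]]]; [left|right; exists q; split=> //].
    move=> g lg gN z; rewrite in_cons => /predU1P[->|]; last exact: IH.
    exact: ygt.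
  move=> g lg gN z; rewrite in_cons => /predU1P[->|]; last exact: qP.
  by rewrite leNgt ygt.
pose q1 := cap_support N y (p y + e).
have sq1 : sublinear q1 by exact: cap_support_sublinear.
have q1N x : q1 x <= N x by exact: cap_support_le.
have npq1 : ~ forall x, p x <= q1 x.
  move=> /(_ (- y)) /(cap_support_attained sN cN lp) ?; lra.
have q1P g : scalar g -> (forall x, g x <= N x) -> p y + e <= g y ->
    forall x, g x <= q1 x by move=> *; exact: le_cap_support.
right; case: IH => [IH|[q [sq qN npq qP]]].
  exists q1; split=> // g lg gN z; rewrite in_cons => /predU1P[->|].
    exact: q1P.
  by move=> /(IH g lg gN); rewrite ltNge => /negP.
(* The maximum stands for the convex hull of two sets not containing [p]; [extremal_le_max] keeps
   the extremal [p] out of the hull. *)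
exists (fun x => Num.max (q1 x) (q x)); split.
- split=> [x x'|t x t0] /=.
    rewrite ge_max; apply/andP; split.
      by apply: le_trans (sq1.1 _ _) _; rewrite lerD// le_max lexx.
    by apply: le_trans (sq.1 _ _) _; rewrite lerD// le_max lexx orbT.
  by rewrite (sublinearZ _ sq1 t0) (sublinearZ _ sq t0) (maxr_pMr _ _ (ltW t0)).
- by move=> x; rewrite ge_max q1N qN.
- by move=> /(extremal_le_max extp sq1 sq q1N qN)[].
- move=> g lg gN z; rewrite in_cons => /predU1P[->|zs] pg x; rewrite le_max.
    by rewrite q1P.
  by rewrite (qP g lg gN z zs pg) orbT.
Qed.

End ExtremalSlices.

(** * Real and complex scalars *)

Section Scalars.
Context {R : realType} {k : scalar_kind}.
Local Notation K := (scalar_field R k).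
Local Notation re := (@scalar_re R k).
Implicit Types (r s : R) (z w : K).

Definition embed r : K :=
  match k return scalar_field R k with
  | RealScalars => r
  | ComplexScalars => Complex r 0
  end.

Lemma embed_le r s : (embed r <= embed s) = (r <= s).
Proof. by rewrite /embed; case: k => //=; rewrite lecE /= eqxx. Qed.

Lemma embed_lt r s : (embed r < embed s) = (r < s).
Proof. by rewrite /embed; case: k => //=; rewrite ltcE /= eqxx. Qed.

Lemma embedD r s : embed (r + s) = embed r + embed s.
Proof.
by rewrite /embed; case: k => //=; apply/eqP; rewrite eq_complex/= addr0 !eqxx.
Qed.

Lemma embedN r : embed (- r) = - embed r.
Proof.
by rewrite /embed; case: k => //=; apply/eqP; rewrite eq_complex/= oppr0 !eqxx.
Qed.

Lemma embedB r s : embed (r - s) = embed r - embed s.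
Proof. by rewrite embedD embedN. Qed.

Lemma embedM r s : embed (r * s) = embed r * embed s.
Proof.
rewrite /embed; case: k => //=; apply/eqP; rewrite eq_complex/=.
by rewrite !(mulr0, mul0r) addr0 subr0 !eqxx.
Qed.

Lemma embed0 : embed 0 = 0.
Proof. by rewrite /embed; case: k. Qed.

Lemma embed1 : embed 1 = 1.
Proof. by rewrite /embed; case: k. Qed.

Lemma embed_re r : re (embed r) = r.
Proof. by rewrite /embed /scalar_re; case: k. Qed.

Lemma reD z w : re (z + w) = re z + re w.
Proof. by move: z w; rewrite /scalar_re; case: k => //= -[? ?] [? ?]. Qed.

Lemma reN z : re (- z) = - re z.
Proof. by move: z; rewrite /scalar_re; case: k => //= -[? ?]. Qed.

Lemma reZ r z : re (embed r * z) = r * re z.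
Proof.
move: z; rewrite /embed /scalar_re; case: k => //= -[? ?] /=.
by rewrite mul0r subr0.
Qed.

(** In [R[i]] too, [0 <= z] forces [z] to be real; this is what lets norms be handled as elements of
    [R]. *)
Lemma ge0_embed z : 0 <= z -> z = embed (re z).
Proof.
move: z; rewrite /embed /scalar_re; case: k => //= -[a b] /=.
by rewrite lecE/= => /andP[/eqP-> _].
Qed.

Lemma re_le_norm z : re z <= re `|z|.
Proof.
move: z; rewrite /scalar_re; case: k => /= z; first exact: ler_norm.
apply: (le_trans (ler_norm _)).
by have := normc_ge_Re z; rewrite -[leRHS]/(`|z|) lecE/= => /andP[].
Qed.

Lemma norm_1B z : re `|1 - z| ^+ 2 = 1 - 2 * re z + re `|z| ^+ 2.
Proof.
move: z; rewrite /scalar_re; case: k => /= [z|[a b]].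
  by rewrite !real_normK ?num_real//; ring.
rewrite -[X in X ^+ 2 = _]/(Num.sqrt ((1 - a) ^+ 2 + (0 - b) ^+ 2)).
rewrite -[X in _ = _ + X ^+ 2]/(Num.sqrt (a ^+ 2 + b ^+ 2)).
by rewrite !sqr_sqrtr ?addr_ge0 ?sqr_ge0//=; ring.
Qed.

(* With the value [0] for real scalars, one formula recovers a functional from
   its real part over both fields. *)
Definition imunit : K :=
  match k return scalar_field R k with
  | RealScalars => 0
  | ComplexScalars => Complex 0 1
  end.

Lemma scalar_imunit z : z = embed (re z) - imunit * embed (re (imunit * z)).
Proof.
move: z; rewrite /embed /scalar_re /imunit; case: k => /= [z|[a b]].
  by rewrite mul0r subr0.
by apply/eqP; rewrite eq_complex /=; apply/andP; split; apply/eqP; ring.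
Qed.

(** The recipe [g x - i * g (i x)] commutes with [i] because [i (i x) = - x]; over the reals both
    sides are [0]. *)
Lemma imunitK (V : lmodType K) (g : V -> R) :
  g 0 = 0 -> (forall x, g (- x) = - g x) -> forall x,
  embed (g (imunit *: x)) - imunit * embed (g (imunit *: (imunit *: x))) =
  imunit * (embed (g x) - imunit * embed (g (imunit *: x))).
Proof.
move: V g; rewrite /embed /imunit; case: k => V g /= g0 gN x.
  by rewrite !scale0r g0 !mul0r subr0.
have -> : Complex (0 : R) 1 *: (Complex 0 1 *: x) = - x.
  rewrite scalerA -scaleN1r; congr (_ *: _).
  by apply/eqP; rewrite eq_complex/=; apply/andP; split; apply/eqP; ring.
rewrite gN; apply/eqP; rewrite eq_complex /=.
by apply/andP; split; apply/eqP; ring.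
Qed.

Lemma re_imunit r : re (imunit * embed r) = 0.
Proof.
rewrite /embed /scalar_re /imunit; case: k => /=; rewrite ?mul0r//.
by rewrite mulr0 subr0.
Qed.

Lemma norm_imunit : `|imunit| <= 1.
Proof.
rewrite /imunit; case: k => /=; first by rewrite normr0.
by rewrite normc_def/= expr0n expr1n add0r sqrtr1.
Qed.

Definition nrm (V : normedModType K) (x : V) : R := re `|x|.

Section NormedModule.
Context {V : normedModType K}.
Implicit Types x y : V.

Lemma nrmE x : `|x| = embed (nrm x).
Proof. exact/ge0_embed. Qed.

Lemma nrm_ge0 x : 0 <= nrm x.
Proof. by rewrite -embed_le embed0 -nrmE. Qed.

Lemma nrmD x y : nrm (x + y) <= nrm x + nrm y.
Proof. by rewrite -embed_le embedD -!nrmE ler_normD. Qed.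

Lemma nrmN x : nrm (- x) = nrm x.
Proof. by rewrite /nrm normrN. Qed.

Lemma nrmB x y : nrm (x - y) = nrm (y - x).
Proof. by rewrite /nrm distrC. Qed.

Lemma nrmZ (z : K) x : nrm (z *: x) = nrm (z : K^o) * nrm x.
Proof. by rewrite /nrm normrZ {1}(ge0_embed (normr_ge0 z)) reZ. Qed.

Lemma nrm_embed r : 0 <= r -> nrm (embed r : K^o) = r.
Proof. by move=> r0; rewrite /nrm ger0_norm ?embed_re// -embed0 embed_le. Qed.

Lemma nrm_unit (w : K) x : `|w| = 1 -> nrm (w *: x) = nrm x.
Proof. by move=> w1; rewrite /nrm normrZ w1 mul1r. Qed.

Lemma nrm0 : nrm (0 : V) = 0.
Proof. by rewrite /nrm normr0 -embed0 embed_re. Qed.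

Lemma nrm_triangle x' x y : nrm (x - y) <= nrm (x - x') + nrm (x' - y).
Proof. by have := nrmD (x - x') (x' - y); rewrite addrA subrK. Qed.

End NormedModule.

Lemma exists_rotation z : exists2 w : K, `|w| = 1 & w * z = `|z|.
Proof.
have [->|z0] := eqVneq z 0; first by exists 1; rewrite ?normr1// normr0 mulr0.
exists (`|z| / z); last by rewrite divfK.
by rewrite normrM normfV normr_id divff// normr_eq0.
Qed.

Lemma nrm_le_re z : nrm (z : K^o) <= `|re z| + `|re (imunit * z)|.
Proof.
have nE r : nrm (embed r : K^o) = `|r|.
  case: (ger0P r) => r0; first exact: nrm_embed.
  by rewrite -(@nrmN K^o) -embedN nrm_embed// oppr_ge0 ltW.
rewrite [in leLHS](scalar_imunit z).
apply: le_trans (nrmD (embed (re z) : K^o) _) _; rewrite nrmN nE lerD2l.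
rewrite (nrmZ imunit (embed (re (imunit * z)) : K^o)) nE ler_piMl//.
by rewrite -(@embed_le) -nrmE embed1 norm_imunit.
Qed.

(** A synonym carries the real scalar multiplication, so that it does not compete with the one over
    [K]. *)
Definition realify (V : lmodType K) : Type := V.

Section Realify.
Variable V : lmodType K.
HB.instance Definition _ := GRing.Zmodule.on (realify V).
Definition rscale r (x : realify V) : realify V := embed r *: (x : V).
Let rscaleA a b v : rscale a (rscale b v) = rscale (a * b) v.
Proof. by rewrite /rscale scalerA embedM. Qed.
Let rscale1 : left_id 1 rscale.
Proof. by move=> v; rewrite /rscale embed1 scale1r. Qed.
Let rscaleDr : right_distributive rscale +%R.
Proof. by move=> a u v; rewrite /rscale scalerDr. Qed.
Let rscaleDl v : {morph rscale^~ v : a b / a + b}.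
Proof. by move=> a b; rewrite /rscale embedD scalerDl. Qed.
HB.instance Definition _ := GRing.Zmodule_isLmodule.Build R (realify V)
  rscaleA rscale1 rscaleDr rscaleDl.

Lemma realifyZ r (x : V) : r *: (x : realify V) = embed r *: x.
Proof. by []. Qed.
End Realify.

End Scalars.

(** * Convexity and functionals over the scalar field *)

Section Convexity.
Context {R : realType} {k : scalar_kind}.
Local Notation K := (scalar_field R k).
Local Notation re := (@scalar_re R k).
Context {V : normedModType K}.
Implicit Types (A C : set V) (x y : V) (t : R).

(** Real weights suffice because elements of [K] between [0] and [1] are real; see [rconvexE]. *)
Definition rconvex C := forall x y t, 0 <= t <= 1 -> C x -> C y ->
  C (embed t *: x + embed (1 - t) *: y).

Lemma rconvexE C : rconvex C <-> convex_set (C : set (convex_lmodType V)).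
Proof.
split=> [cC x y l /set_mem Cx /set_mem Cy|cC x y t /andP[t0 t1] Cx Cy].
  apply/mem_set; rewrite /conv /=.
  have l0 : 0 <= l%:num by exact: ge0.
  have l1 : l%:num <= 1 by exact: le1.
  have lE := ge0_embed l0.
  have := cC x y (re l%:num); rewrite embedB embed1 -lE; apply => //.
  by rewrite -!(@embed_le _ k) -lE embed0 embed1 l0 l1.
have t0' : (0 : K) <= embed t by rewrite -embed0 embed_le.
have t1' : embed t <= (1 : K) by rewrite -embed1 embed_le.
have := cC x y (Itv01 t0' t1') (mem_set Cx) (mem_set Cy) => /set_mem.
by rewrite /conv /= embedB embed1.
Qed.

Lemma conv_rconvex A : rconvex (Defs.conv A).
Proof.
move=> x y t t01 Ax Ay C CP; have [/rconvexE cC _] := CP.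
by apply: cC => //; [exact: Ax|exact: Ay].
Qed.

Lemma sub_conv A : A `<=` Defs.conv A.
Proof. by move=> x Ax C [_]; apply. Qed.

Lemma conv_min A C : rconvex C -> A `<=` C -> Defs.conv A `<=` C.
Proof. by move=> /rconvexE cC AC x convx; exact: convx. Qed.

Lemma closure_nrmP A x :
  closure A x <-> forall d : R, 0 < d -> exists2 a, A a & nrm (x - a) < d.
Proof.
split=> [clA d d0|clA B].
  have /clA[a [Aa /=]] : nbhs x [set y | nrm (x - y) < d].
    apply/nbhs_normP; exists (embed d) => /=.
      by rewrite -embed0 embed_lt.
    by move=> y /=; rewrite nrmE embed_lt.
  by exists a.
move=> /nbhs_normP[e /= e0 eB].
have eE := ge0_embed (ltW e0).
have [|a Aa xa] := clA (re e); first by rewrite -(@embed_lt _ k) -eE embed0.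
by exists a; split=> //; apply: eB; rewrite /= nrmE eE embed_lt.
Qed.

Lemma nrm_le1P x : unit_ball V x <-> nrm x <= 1.
Proof. by rewrite /unit_ball /= nrmE -embed1 embed_le. Qed.

Lemma nrm_rconvex : rconvex [set x | nrm x <= 1].
Proof.
move=> x y t /andP[t0 t1] /= x1 y1; apply: (le_trans (nrmD _ _)).
rewrite !nrmZ !nrm_embed ?subr_ge0//.
have : t * nrm x <= t * 1 by rewrite ler_wpM2l.
have : (1 - t) * nrm y <= (1 - t) * 1 by rewrite ler_wpM2l ?subr_ge0.
by move=> ? ?; lra.
Qed.

End Convexity.

(** * Functionals and their real parts *)

Section Functionals.
Context {R : realType} {k : scalar_kind}.
Local Notation K := (scalar_field R k).
Local Notation re := (@scalar_re R k).

Lemma op_nrm_ub (X Y : normedModType K) (G : bounded_op X Y) x :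
  nrm (G x) <= nrm G * nrm x.
Proof.
have [->|x0] := eqVneq x 0; first by rewrite linear0 !nrm0 mulr0.
have nx0 : 0 < nrm x by rewrite -(@embed_lt _ k) -nrmE embed0 normr_gt0.
rewrite -ler_pdivrMr// mulrC -(@embed_le _ k) -nrmE.
have -> : embed ((nrm x)^-1 * nrm (G x)) = `|G (embed (nrm x)^-1 *: x)|.
  by rewrite linearZ nrmE nrmZ nrm_embed// invr_ge0 ltW.
apply: op_norm_ub; rewrite nrmE nrmZ nrm_embed ?invr_ge0 ?nrm_ge0//.
by rewrite (mulVf (lt0r_neq0 nx0)) embed1.
Qed.

Variable X : normedModType K.
Implicit Types (f : dual X) (x : X).

Lemma dualZ f (z : K) x : f (z *: x) = z * f x.
Proof. exact: (linearZ_LR (f : bounded_op X K^o) z x). Qed.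

Lemma dualD f x y : f (x + y) = f x + f y.
Proof. exact: (raddfD (f : bounded_op X K^o) x y). Qed.

Lemma dualB f x y : f (x - y) = f x - f y.
Proof. exact: (raddfB (f : bounded_op X K^o) x y). Qed.

Lemma re_scalar f : scalar (fun x : realify X => re (f x)).
Proof. by move=> a x y; rewrite dualD reD realifyZ dualZ reZ. Qed.

Lemma nrm_sublinear : sublinear (fun x : realify X => nrm (x : X)).
Proof.
split=> [x y|t x t0]; first exact: nrmD.
by rewrite realifyZ nrmZ nrm_embed// ltW.
Qed.

Lemma re_dual_le f x : re (f x) <= nrm f * nrm x.
Proof.
apply: le_trans (op_nrm_ub (f : bounded_op X K^o) x).
exact: re_le_norm.
Qed.

(** Rotating [x] makes [f x] real and nonnegative, so real parts alone determine the dual norm. *)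
Lemma nrm_dual_le f r : (forall x, nrm x <= 1 -> re (f x) <= r) -> nrm f <= r.
Proof.
move=> fr; rewrite -(@embed_le _ k) -nrmE; apply: op_norm_le => x x1.
have [w w1 wf] := exists_rotation (f x).
rewrite -[X in X <= _]wf -dualZ.
have -> : f (w *: x) = embed (re (f (w *: x))).
  by rewrite dualZ wf; exact: ge0_embed.
by rewrite embed_le; apply: fr; rewrite nrm_unit//; apply/nrm_le1P.
Qed.

Lemma nrm_dual_gt f r : r < nrm f -> exists2 x, nrm x <= 1 & r < re (f x).
Proof.
move=> rf; apply: contrapT => nx; move: rf; rewrite ltNge => /negP; apply.
apply: nrm_dual_le => x x1; rewrite leNgt; apply/negP => rx.
by apply: nx; exists x.
Qed.

Lemma nrm_dual_le1 f x : nrm f <= 1 -> re (f x) <= nrm x.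
Proof.
move=> f1; apply: (le_trans (re_dual_le f x)).
by rewrite ler_piMl// nrm_ge0.
Qed.

(** The functional is [g x - i * g (i x)]; it is bounded since a rotation [w] makes its modulus at
    [x] equal to [g (w *: x)]. *)
Lemma functional_of_re (g : realify X -> R) (c : R) : 0 <= c -> scalar g ->
  (forall x, g x <= c * nrm (x : X)) ->
  exists f : dual X, forall x, re (f x) = g x.
Proof.
move=> c0 lg gc.
pose f (x : X) : K^o := embed (g x) - imunit * embed (g (imunit *: x)).
have reE x : re (f x) = g x by rewrite /f reD reN re_imunit embed_re subr0.
have fD x y : f (x + y) = f x + f y.
  rewrite /f scalerDr !(scalarfD _ _ lg) !embedD mulrDr opprD.
  by rewrite addrACA.
have fR (r : R) x : f (embed r *: x) = embed r * f x.
  rewrite /f scalerA [imunit * embed r]mulrC -scalerA -!(@realifyZ R k X).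
  by rewrite !(scalarfZ _ _ lg) !embedM mulrBr mulrCA.
have fI x : f (imunit *: x) = imunit * f x.
  apply: (@imunitK _ _ X g); first exact: (scalarf0 lg).
  by move=> y; exact: (scalarfN (y : realify X) lg).
have fN x : f (- x) = - f x.
  by rewrite -scaleN1r -embed1 -embedN fR embedN embed1 mulN1r.
have lf : linear f.
  move=> z x y; rewrite fD; congr (_ + _).
  rewrite {1}(scalar_imunit z) scalerBl fD fN -scalerA fI !fR.
  by rewrite [RHS](_ : _ = z * f x)// [in RHS](scalar_imunit z) mulrBl mulrA.
pose F : {linear X -> K^o} :=
  HB.pack f (GRing.isLinear.Build K X K^o *:%R f lf).
have Fc x : `|F x| <= embed c * `|x|.
  have [w w1 wf] := exists_rotation (F x).
  have wfE : w * F x = F (w *: x) by rewrite linearZ.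
  rewrite -[X in X <= _]wf wfE.
  have -> : F (w *: x) = embed (g (w *: x)).
    by rewrite -reE -[f _]/(F _) -wfE wf; exact: ge0_embed.
  by rewrite nrmE -embedM embed_le -(nrm_unit x w1).
have cF : continuous f.
  apply/(linear_bounded_continuous F)/linear_boundedP; exists (embed c); split.
    by rewrite ger0_real// -embed0 embed_le.
  by move=> M cM x; apply: (le_trans (Fc x)); rewrite ler_wpM2r// ltW.
have fP : f \in @is_bounded_op K X K^o by apply/asboolP.
by exists (BoundedOp fP).
Qed.

End Functionals.

(** * Spear functionals and slices *)

Section Slices.
Context {R : realType} {k : scalar_kind}.
Local Notation K := (scalar_field R k).
Local Notation re := (@scalar_re R k).
Variable X : normedModType K.
Implicit Types (f g h : dual X) (x a : X) (e d t : R).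

Definition slice f e : set X := [set x | nrm x <= 1 /\ 1 - e < re (f x)].

Definition slice_dense f e := forall x d, nrm x <= 1 -> 0 < d ->
  exists2 a, aconv (slice f e) a & nrm (x - a) < d.

Lemma slice_rconvex f e : rconvex (slice f e).
Proof.
move=> x y t t01 [x1 fx] [y1 fy]; split; first exact: (@nrm_rconvex _ _ X).
rewrite dualD !dualZ reD !reZ; case/andP: t01 => t0 t1.
have [->|tn0] := eqVneq t 0; first by rewrite mul0r subr0 mul1r add0r.
have {tn0}t0 : 0 < t by rewrite lt_neqAle eq_sym tn0.
have : t * (1 - e) < t * re (f x) by rewrite ltr_pM2l.
have : (1 - t) * (1 - e) <= (1 - t) * re (f y).
  by rewrite ler_wpM2l ?subr_ge0// ltW.
by move=> ? ?; lra.
Qed.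

Lemma aconv_unit (F : set X) (w : K) x : `|w| = 1 -> F x -> aconv F (w *: x).
Proof. by move=> w1 Fx; apply: sub_conv; exists w => //; exists x. Qed.

Lemma aconv_rconvex (F : set X) : rconvex (aconv F).
Proof. exact: conv_rconvex. Qed.

(** Serves as induction on absolutely convex hulls: a property stable under convex combinations is
    checked on rotated generators. *)
Lemma aconv_min (F C : set X) : rconvex C ->
  (forall w x, `|w| = 1 -> F x -> C (w *: x)) -> aconv F `<=` C.
Proof.
by move=> cC FC; apply: conv_min => // _ [w w1 [x Fx <-]]; exact: FC.
Qed.

Lemma aconv0 (F : set X) : F !=set0 -> aconv F 0.
Proof.
case=> x Fx.
have := @aconv_rconvex F (1 *: x) (-1 *: x) (1 / 2).
rewrite scale1r scaleN1r (_ : 1 - 1 / 2 = 1 / 2); last by lra.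
rewrite scalerN subrr; apply; first by lra.
  by rewrite -[x]scale1r; apply: aconv_unit; rewrite ?normr1.
by rewrite -scaleN1r; apply: aconv_unit; rewrite ?normrN1.
Qed.

Lemma aconv_nonempty (F : set X) : aconv F !=set0 -> F !=set0.
Proof.
move=> [a Fa]; apply: contrapT => F0.
have : aconv F `<=` set0; last by move/(_ a Fa).
apply: aconv_min => [? ? ? ? []|w x _ Fx]; by apply: F0; exists x.
Qed.

Lemma aconv_ball (F : set X) : (forall x, F x -> nrm x <= 1) ->
  aconv F `<=` [set x | nrm x <= 1].
Proof.
move=> F1; apply: aconv_min; first exact: nrm_rconvex.
by move=> w x w1 Fx; rewrite /= nrm_unit//; exact: F1.
Qed.

Lemma spearP f : spear (dual X) f -> nrm f = 1 /\ forall g e, 0 < e ->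
  exists2 w : K, `|w| = 1 & 1 + nrm g - e < nrm (f + w *: g).
Proof.
move=> [f1 fsup]; split.
  by rewrite /nrm f1 -(@embed1 _ k) embed_re.
move=> g e e0; apply: contrapT => nw.
have [_ /(_ (embed (1 + nrm g - e)))] := fsup g.
have -> : 1 + `|g| = embed (1 + nrm g) by rewrite nrmE embedD embed1.
rewrite embed_le => H; suff : 1 + nrm g <= 1 + nrm g - e by lra.
apply: H => _ [w w1 <-]; rewrite nrmE embed_le leNgt; apply/negP => wg.
by apply: nw; exists w.
Qed.

Lemma dualDZ f (w : K) g x : (f + w *: g : dual X) x = f x + w * g x.
Proof. by []. Qed.

Lemma slice_spear f : nrm f <= 1 -> (forall e, 0 < e -> slice_dense f e) ->
  spear (dual X) f.
Proof.
move=> f1 fslice; have fE : nrm f = 1.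
  apply/eqP; rewrite eq_le f1 leNgt; apply/negP => f_lt1.
  (* For this width the slice requires [re (f x) > nrm f], impossible in the ball. *)
  have e0 : 0 < 1 - nrm f by lra.
  have [a Fa _] := fslice _ e0 0 1 ltac:(by rewrite nrm0) ltr01.
  have [x [x1]] := aconv_nonempty (ex_intro _ a Fa).
  have := re_dual_le f x; have := ler_wpM2l (nrm_ge0 f) x1.
  by rewrite mulr1; lra.
split=> [|g]; first by rewrite /unit_sphere /= nrmE fE embed1.
split=> [_ [w w1 <-]|u uub].
  by apply: (le_trans (ler_normD _ _)); rewrite normrZ w1 mul1r nrmE fE embed1.
have u0 : 0 <= u.
  apply: (le_trans (normr_ge0 (f + 1 *: g))); apply: uub.
  by exists 1 => //; rewrite /unit_scalars/= normr1.
rewrite (ge0_embed u0) nrmE -(@embed1 _ k) -embedD embed_le.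
apply/ler_addgt0Pr => n n0; rewrite leNgt; apply/negP => un.
(* One [e] is lost at [x], which nearly norms [g], one in passing to [a], and one in
   [re (f y) > 1 - e] on the slice. *)
pose e := n / 3; have e0 : 0 < e by rewrite /e; lra.
have [x x1 gx] := @nrm_dual_gt _ _ _ g (nrm g - e) ltac:(lra).
have g1 : 0 < nrm g + 1 by have := nrm_ge0 g; lra.
have [a Fa xa] := fslice e e0 x (e / (nrm g + 1)) x1 ltac:(by rewrite divr_gt0).
have : re (g a) <= nrm g - 2 * e.
  move: a Fa {xa}.
  apply: (@aconv_min _ [set a | re (g a) <= nrm g - 2 * e]).
    move=> y z t /andP[t0 t1] /= yC zC.
    rewrite dualD !dualZ reD !reZ.
    have := ler_wpM2l t0 yC.
    have := @ler_wpM2l _ (1 - t) ltac:(lra) _ _ zC.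
    by lra.
  move=> w y w1 [y1 fy].
  have := @re_dual_le _ _ _ (f + w *: g) y; rewrite dualDZ reD /= dualZ.
  have := ler_wpM2l (nrm_ge0 (f + w *: g)) y1.
  have : nrm (f + w *: g) <= re u.
    rewrite -(@embed_le _ k) -nrmE -(ge0_embed u0); apply: uub.
    by exists w.
  by rewrite mulr1 /e; move: un fy; rewrite /e; lra.
have := re_dual_le g (x - a); rewrite dualB reD reN.
have : nrm g * nrm (x - a) <= e.
  have : (nrm g + 1) * nrm (x - a) <= e.
    by rewrite mulrC -ler_pdivlMr// ltW.
  by have := nrm_ge0 (x - a); lra.
by lra.
Qed.

(** * A gauge separating a convex set from distant points *)

Section ConeGauge.
Variables (A : set X) (c : R).
Hypotheses (cA : rconvex A) (A0 : A 0) (c0 : 0 <= c).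

(* The gauge is at most [1] on [A] and at most [c] times the norm; a linear
   functional below it therefore separates [A] from points of larger gauge. *)
Definition cone_gauge_set (x : realify X) : set R :=
  [set r | exists t (a : X), [/\ 0 < t, A a &
     r = t + c * nrm ((x : X) - embed t *: a)]].

Definition cone_gauge (x : realify X) : R := inf (cone_gauge_set x).

Lemma cone_gauge_has_inf x : has_inf (cone_gauge_set x).
Proof.
split; first by exists (1 + c * nrm ((x : X) - embed 1 *: 0)), 1, 0.
exists 0 => _ [t [a [t0 _ ->]]].
by rewrite addr_ge0 ?(ltW t0)// mulr_ge0// nrm_ge0.
Qed.

Lemma cone_gauge_le x t a : 0 < t -> A a ->
  cone_gauge x <= t + c * nrm ((x : X) - embed t *: a).
Proof.
move=> t0 Aa; apply: ge_inf; first by case: (cone_gauge_has_inf x).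
by exists t, a.
Qed.

Lemma cone_gauge_sublinear : sublinear cone_gauge.
Proof.
apply: sublinear_inf; first exact: cone_gauge_has_inf.
- move=> x y _ _ [t [a [t0 Aa ->]]] [s [b [s0 Ab ->]]].
  have ts0 : 0 < t + s by rewrite addr_gt0.
  pose l := t / (t + s).
  have l01 : 0 <= l <= 1.
    by rewrite /l divr_ge0 ?(ltW t0) ?(ltW ts0)//= ler_pdivrMr// mul1r; lra.
  pose z := embed l *: a + embed (1 - l) *: b.
  exists (t + s + c * nrm ((x + y : X) - embed (t + s) *: z)).
    by exists (t + s), z; split=> //; exact: cA.
  have -> : (x + y : X) - embed (t + s) *: z =
      ((x : X) - embed t *: a) + ((y : X) - embed s *: b).
    rewrite /z scalerDr !scalerA -!embedM.
    have -> : (t + s) * l = t by rewrite mulrC divfK// gt_eqF.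
    have -> : (t + s) * (1 - l) = s.
      by rewrite mulrBr mulr1 mulrC divfK ?gt_eqF//; lra.
    by rewrite opprD addrACA.
  have := ler_wpM2l c0 (nrmD ((x : X) - embed t *: a) ((y : X) - embed s *: b)).
  by lra.
- move=> s x _ s0 [t [a [t0 Aa ->]]].
  exists (s * t + c * nrm ((s *: x : X) - embed (s * t) *: a)).
    by exists (s * t), a; split=> //; rewrite mulr_gt0.
  rewrite realifyZ embedM -scalerA -scalerBr nrmZ nrm_embed ?(ltW s0)//.
  by rewrite mulrDr mulrCA.
Qed.

Lemma cone_gauge_le_nrm x : cone_gauge x <= c * nrm (x : X).
Proof.
apply/ler_addgt0Pr => t t0; have := cone_gauge_le x t0 A0.
by rewrite scaler0 subr0 addrC.
Qed.

Lemma cone_gauge_le1 a : A a -> cone_gauge a <= 1.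
Proof.
move=> Aa; have := cone_gauge_le a ltr01 Aa.
by rewrite embed1 scale1r subrr nrm0 mulr0 addr0.
Qed.

End ConeGauge.

(** The constant makes a distance [d] cost [1 + d]. For [t <= 1] the point [t a] stays in [A]; for
    [t] up to [1 + d] it is within [d] of [a]; beyond that, [t] alone suffices. *)
Lemma cone_gauge_gt (A : set X) d x :
  rconvex A -> A 0 -> A `<=` [set a | nrm a <= 1] -> 0 < d ->
  (forall a, A a -> 2 * d <= nrm (x - a)) ->
  1 + d <= cone_gauge A ((1 + d) / d) x.
Proof.
move=> cA A0 A1 d0 Ax.
have cd : (1 + d) / d * d = 1 + d by rewrite divfK ?gt_eqF.
have c0 : 0 <= (1 + d) / d by rewrite divr_ge0; lra.
have key r : d <= r -> 1 + d <= (1 + d) / d * r.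
  by move=> dr; rewrite -[leLHS]cd ler_wpM2l.
apply: lb_le_inf; first by case: (cone_gauge_has_inf A0 c0 x).
move=> _ [t [a [t0 Aa ->]]].
have [t1|t1] := leP t 1.
  have := cA a 0 t; rewrite scaler0 addr0 => /(_ _ Aa A0) At.
  have {}At : A (embed t *: a) by apply: At; lra.
  have := key (nrm (x - embed t *: a)); have := Ax _ At; lra.
have [td|td] := leP t (1 + d); last first.
  have := mulr_ge0 c0 (nrm_ge0 (x - embed t *: a)); lra.
suff : d <= nrm (x - embed t *: a) by move=> /key; lra.
have := nrm_triangle (embed t *: a) x a.
have -> : embed t *: a - a = embed (t - 1) *: a.
  by rewrite embedB embed1 scalerBl scale1r.
rewrite nrmZ nrm_embed; last by lra.
have := Ax _ Aa; have := @ler_wpM2l _ (t - 1) ltac:(lra) _ _ (A1 _ Aa); lra.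
Qed.

(** Otherwise Hahn-Banach below the gauge yields [h] with real part at most [1] on [A] and norm at
    least [1 + s]. A point nearly norming [f + w h] lies in the slice, yet the real part of [h]
    exceeds [1] at its rotation by [w]. *)
Lemma spear_slice f e : spear (dual X) f -> 0 < e -> slice_dense f e.
Proof.
move=> /spearP[f1 fP] e0 x0 d x01 d0; apply: contrapT => nxa.
pose A := aconv (slice f e).
have S0 : slice f e !=set0.
  have [|x x1 fx] := @nrm_dual_gt _ _ _ f (1 - e); first by rewrite f1; lra.
  by exists x.
have A0 : A 0 by exact: aconv0.
have cA : rconvex A by exact: aconv_rconvex.
have A1 : A `<=` [set a | nrm a <= 1] by apply: aconv_ball => x [].
pose s := d / 2; have s0 : 0 < s by rewrite /s; lra.
pose c := (1 + s) / s; have c0 : 0 <= c by rewrite /c divr_ge0; lra.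
have Ax a : A a -> 2 * s <= nrm (x0 - a).
  move=> Aa; rewrite /s leNgt; apply/negP => xa; apply: nxa; exists a => //.
  by move: xa; lra.
have [g [lg gq _] gx0] :=
  exists_extremal (x0 : realify X) (cone_gauge_sublinear cA A0 c0).
have [|h hE] := functional_of_re c0 lg.
  by move=> x; apply: le_trans (gq x) _; exact: cone_gauge_le_nrm.
have h1 : 1 + s <= nrm h.
  have := re_dual_le h x0; have := ler_wpM2l (nrm_ge0 h) x01.
  by have := cone_gauge_gt cA A0 A1 s0 Ax; rewrite mulr1 hE gx0; lra.
pose n := Num.min e s.
have n0 : 0 < n by rewrite lt_min e0.
have [w w1 fw] := fP h _ n0.
have [x x1] := nrm_dual_gt fw; rewrite dualDZ reD -dualZ => fx.
have ne : n <= e by rewrite ge_min lexx.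
have ns : n <= s by rewrite ge_min lexx orbT.
have := re_dual_le f x; rewrite f1 mul1r => fx1.
have := re_dual_le h (w *: x); rewrite (nrm_unit _ w1) => hx.
have := ler_wpM2l (nrm_ge0 h) x1; rewrite mulr1 => hx1.
have xS : slice f e x by split=> //; lra.
have := gq (w *: x); have := cone_gauge_le1 A0 c0 (aconv_unit w1 xS).
by rewrite -hE; lra.
Qed.

End Slices.

(** * Approximation by faces *)

Lemma exists_half_power_lt (R : archiRealFieldType) (c e : R) :
  0 <= c -> 0 < e -> exists n, c / 2 ^+ n < e.
Proof.
move=> c0 e0; exists (Num.bound (c / e)).
rewrite ltr_pdivrMr ?exprn_gt0// [e * _]mulrC -ltr_pdivrMr//.
apply: (@lt_trans _ _ (Num.bound (c / e))%:R).
  by apply: archi_boundP; rewrite divr_ge0// ltW.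
by rewrite -natrX ltr_nat ltn_expl.
Qed.

(** * Successive approximation in complete spaces *)

Section Completeness.
Context {R : realType} {k : scalar_kind}.
Local Notation K := (scalar_field R k).
Variable V : completeNormedModType K.

Lemma shrinking_cvg (u : nat -> V) (r : nat -> R) : (forall n, 0 < r n) ->
  (forall n, r n.+1 <= r n / 2) -> (forall n, nrm (u n.+1 - u n) <= r n / 2) ->
  exists l, forall n, nrm (l - u n) <= r n.
Proof.
move=> r0 r2 u2.
have um n m : nrm (u (n + m)%N - u n) <= r n - r (n + m)%N.
  elim: m => [|m IH]; first by rewrite addn0 !subrr nrm0.
  have := nrm_triangle (u (n + m)%N) (u (n + m).+1) (u n).
  have := u2 (n + m)%N; have := r2 (n + m)%N; have := r0 (n + m)%N.
  by rewrite addnS; lra.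
have rn n : r n <= r 0%N / 2 ^+ n.
  elim: n => [|n IH]; first by rewrite expr0 divr1.
  by rewrite exprSr invfM mulrA; have := r2 n; lra.
have r_small e : 0 < e -> exists n, r n < e.
  move=> e0; have [n rn_lt] := exists_half_power_lt (ltW (r0 0%N)) e0.
  by exists n; exact: le_lt_trans (rn _) rn_lt.
have cu : cvgn u.
  apply: cauchy_cvg; apply: cauchy_exP => e e0.
  have eE := ge0_embed (ltW e0).
  have [n rne] : exists n, r n < scalar_re e.
    by apply: r_small; rewrite -(@embed_lt _ k) -eE embed0.
  exists (u n); exists n => // m /= /subnKC nm; rewrite -ball_normE /= -nm.
  rewrite nrmE eE embed_lt nrmB; apply: le_lt_trans rne.
  by have := um n (m - n)%N; have := r0 (n + (m - n))%N; lra.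
exists (lim (u @ \oo)) => n; apply/ler_addgt0Pr => e e0.
have [N _ uN] : \forall m \near \oo, nrm (lim (u @ \oo) - u m) < e.
  have /cvgrPdist_lt/(_ (embed e)) := cu.
  rewrite -(@embed0 R k) embed_lt => /(_ e0); apply: filterS => m.
  by rewrite nrmE embed_lt.
have := uN (n + N)%N (leq_addl _ _); have := um n N; have := r0 (n + N)%N.
have := nrm_triangle (u (n + N)%N) (lim (u @ \oo)) (u n); lra.
Qed.

(** Common engine of the two completeness arguments: [P n x r] is what stage [n] achieves at centre
    [x], with room [r] left for all later moves. *)
Lemma approx_limit (P : nat -> V -> R -> Prop) :
  (forall n x r, P n x r -> 0 < r /\
     exists y s, [/\ P n.+1 y s, s <= r / 2 & nrm (y - x) <= r / 2]) ->
  forall x r, P 0%N x r -> exists l, nrm (l - x) <= r /\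
  forall n, exists y s, [/\ P n y s, nrm (l - y) <= s & s <= r / 2 ^+ n].
Proof.
move=> Pstep x0 r0 P0.
pose T := {p : nat * V * R | P p.1.1 p.1.2 p.2}.
pose rel (p q : T) := [/\ (sval q).1.1 = (sval p).1.1.+1,
  (sval q).2 <= (sval p).2 / 2 &
  nrm ((sval q).1.2 - (sval p).1.2) <= (sval p).2 / 2].
have [p|s [s0 sS]] := @dependent_choice T rel _ (exist _ (0%N, x0, r0) P0).
  case: p => -[[n x] r] /= Px; apply/cid.
  have [_ [y [s [Py sr yx]]]] := Pstep _ _ _ Px.
  by exists (exist _ (n.+1, y, s) Py).
pose u n := (sval (s n)).1.2; pose r n := (sval (s n)).2.
have sn n : (sval (s n)).1.1 = n.
  by elim: n => [|n IH]; [rewrite s0|case: (sS n) => ->; rewrite IH].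
have Pn n : P n (u n) (r n) by rewrite -{1}(sn n); exact: (svalP (s n)).
have r_gt0 n : 0 < r n by have [] := Pstep _ _ _ (Pn n).
have r2 n : r n.+1 <= r n / 2 by have [] := sS n.
have u2 n : nrm (u n.+1 - u n) <= r n / 2 by have [] := sS n.
have [l lP] := shrinking_cvg r_gt0 r2 u2.
exists l; split; first by have := lP 0%N; rewrite /u /r s0.
move=> n; exists (u n), (r n); split=> //.
elim: n => [|n IH]; first by rewrite expr0 divr1 /r s0.
by rewrite exprSr invfM mulrA; have := r2 n; lra.
Qed.

End Completeness.

(** * From slices to the norming face *)

Section Faces.
Context {R : realType} {k : scalar_kind}.
Local Notation K := (scalar_field R k).
Local Notation re := (@scalar_re R k).

Section Step.
Variable X : normedModType K.
Implicit Types (f : dual X) (x a b : X) (e s n : R).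

(* If [f] is almost [1] at a combination of rotated points of the slice, most of
   the rotations are close to [1]; without them the combination lies in the
   slice. The estimate is affine in [a], hence need only be checked on generators
   [w *: x], where it is AM-GM applied to [2 * s * |1 - w|]. *)
Lemma slice_absorb f e s n a :
  nrm f <= 1 -> 0 < s -> 0 < n -> 2 * e <= n ^+ 2 ->
  aconv (slice f e) a -> exists2 b, slice f e b &
    2 * s * nrm (a - b) <= 2 * s ^+ 2 + 1 - re (f a) + n.
Proof.
move=> f1 s0 n0 en; move: a.
apply: (@aconv_min _ _ _ _ [set a | exists2 b, slice f e b &
    2 * s * nrm (a - b) <= 2 * s ^+ 2 + 1 - re (f a) + n]).
  move=> x y t t01 [b Sb xb] [c Sc yc].
  exists (embed t *: b + embed (1 - t) *: c); first exact: slice_rconvex.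
  case/andP: t01 => t0 t1; have t1' : 0 <= 1 - t by lra.
  rewrite opprD addrACA -!scalerBr dualD !dualZ reD !reZ.
  apply: (@le_trans _ _ (2 * s * (t * nrm (x - b) + (1 - t) * nrm (y - c)))).
    rewrite ler_wpM2l ?mulr_ge0 ?(ltW s0)//; apply: (le_trans (nrmD _ _)).
    by rewrite !nrmZ !nrm_embed.
  by have := ler_wpM2l t0 xb; have := ler_wpM2l t1' yc; lra.
move=> w x w1 Sx; exists x => //; have [x1 fx] := Sx.
have nw : nrm (w *: x - x) <= nrm (1 - w : K^o).
  rewrite -[X in _ - X]scale1r -scalerBl nrmZ [leRHS]nrmB.
  by rewrite ler_piMr// nrm_ge0.
have w2 : nrm (1 - w : K^o) ^+ 2 = 2 - 2 * re w.
  rewrite /nrm norm_1B w1 -(@embed1 _ k) embed_re; lra.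
have fxw : re (f (w *: x)) <= re w + n.
  rewrite dualZ.
  have -> : w * f x = w - w * (1 - f x).
    by rewrite mulrBr mulr1 opprB addrC subrK.
  (* On the slice, [|1 - f x|^2 <= 2 - 2 * re (f x) < 2 * e <= n ^+ 2]. *)
  suff : re (- (w * (1 - f x))) <= n by rewrite reD; lra.
  apply: (le_trans (re_le_norm _)); rewrite normrN normrM w1 mul1r.
  rewrite -(@ler_pXn2r _ 2) ?nnegrE ?(ltW n0)//; last exact: (@nrm_ge0 _ _ K^o).
  rewrite norm_1B.
  have : re `|f x| <= 1.
    apply: (le_trans (op_nrm_ub (f : bounded_op X K^o) x)).
    by rewrite -[leRHS]mulr1 ler_pM ?nrm_ge0.
  have : 0 <= re `|f x| by exact: (@nrm_ge0 _ _ K^o).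
  by move=> ? ?; nra.
have : 2 * s * nrm (w *: x - x) <= 2 * s * nrm (1 - w : K^o).
  by rewrite ler_wpM2l// mulr_ge0// ltW.
have := sqr_ge0 (nrm (1 - w : K^o) - 2 * s); rewrite sqrrB w2.
by move=> ? ?; lra.
Qed.

(** A nearby [a] in the hull of a far thinner slice has [1 - re (f a) <= 2 * s ^+ 2], so
    [slice_absorb] moves it by at most [5 / 2 * s]; with the initial [s ^+ 2 <= s] the total stays
    under [4 * s]. *)
Lemma slice_refine f x s e :
  nrm f <= 1 -> (forall e, 0 < e -> slice_dense f e) ->
  0 < s <= 1 -> nrm x <= 1 -> 1 - s ^+ 2 < re (f x) -> 0 < e ->
  exists2 b, slice f e b & nrm (b - x) <= 4 * s.
Proof.
move=> f1 fS /andP[s0 s1] x1 fx e0; pose n := s ^+ 2.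
have n0 : 0 < n by rewrite exprn_gt0.
pose e' := Num.min e (n ^+ 2 / 2).
have e'0 : 0 < e' by rewrite lt_min e0 divr_gt0 ?exprn_gt0.
have e'e : e' <= e by rewrite ge_min lexx.
have e'n : 2 * e' <= n ^+ 2.
  have : e' <= n ^+ 2 / 2 by rewrite ge_min lexx orbT.
  by lra.
have [a Aa xa] := fS e' e'0 x n x1 n0.
have [b [b1 fb] ab] := slice_absorb f1 s0 n0 e'n Aa.
exists b; first by split=> //; lra.
have fa : re (f x) <= re (f a) + n.
  by have := nrm_dual_le1 (x - a) f1; rewrite dualB reD reN; lra.
have sab : 2 * s * nrm (a - b) <= 2 * s * (5 / 2 * s).
  by move: ab fa; rewrite /n in fx *; nra.
have {}sab : nrm (a - b) <= 5 / 2 * s.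
  by rewrite -(@ler_pM2l _ (2 * s)) ?mulr_gt0.
have ns : n <= s by rewrite /n expr2 ler_piMl ?(ltW s0).
rewrite nrmB; have := nrm_triangle a x b; lra.
Qed.

End Step.

Variable X : completeNormedModType K.
Implicit Types (f : dual X) (x a b : X) (e s n : R).

Definition norming_face f : set X := [set x | unit_sphere X x /\ re (f x) = 1].

Lemma slice_near_face f x s :
  nrm f <= 1 -> (forall e, 0 < e -> slice_dense f e) ->
  0 < s <= 1 -> slice f (s ^+ 2) x ->
  exists2 y, norming_face f y & nrm (y - x) <= 8 * s.
Proof.
move=> f1 fS /andP[s0 s1] [x1 fx].
(* [slice_refine] with [s = r / 8] moves the point by at most [r / 2], the radius of the next stage;
   [r <= 8] keeps [s <= 1]. *)
pose P (n : nat) y r :=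
  [/\ 0 < r <= 8, nrm y <= 1 & 1 - (r / 8) ^+ 2 < re (f y)].
have [||l [lx lP]] := @approx_limit _ _ X P _ x (8 * s).
- move=> n y r [/andP[r0 r8] y1 fy]; split=> //.
  have [||b [b1 fb] yb] :=
    @slice_refine _ f y (r / 8) ((r / 2 / 8) ^+ 2) f1 fS _ y1 fy.
  + by lra.
  + by rewrite exprn_gt0//; lra.
  by exists b, (r / 2); split; [split=> //; lra|lra|lra].
- by split=> //; [lra|rewrite mulrAC divff ?mul1r].
have lim e : 0 < e -> exists y r, [/\ P 0%N y r, nrm (l - y) <= r & r < e].
  move=> e0; have [|n sn] := @exists_half_power_lt _ (8 * s) e _ e0.
    by lra.
  have [y [r [Py ly r_le]]] := lP n.
  by exists y, r; split=> //; exact: le_lt_trans r_le sn.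
have l1 : nrm l <= 1.
  apply/ler_addgt0Pr => e e0; have [y [r [[_ y1 _] ly re]]] := lim e e0.
  by have := nrmD (l - y) y; rewrite subrK; lra.
have fl : 1 <= re (f l).
  apply/ler_addgt0Pr => e e0.
  have [|y [r [[r08 y1 fy] ly r_lt]]] := lim (Num.min (e / 2) 1).
    by rewrite lt_min ltr01 andbT; lra.
  move: r_lt; rewrite lt_min => /andP[re r1].
  have := nrm_dual_le1 (y - l) f1; rewrite nrmB dualB reD reN.
  by move: fy r08; nra.
exists l => //; split; last first.
  by apply/eqP; rewrite eq_le fl andbT; apply: le_trans (nrm_dual_le1 l f1) _.
rewrite /unit_sphere /= nrmE -(@embed1 _ k); congr embed; apply/eqP.
by rewrite eq_le l1; apply: le_trans fl _; exact: nrm_dual_le1.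
Qed.

Lemma ball_closure_face f :
  nrm f <= 1 -> (forall e, 0 < e -> slice_dense f e) ->
  unit_ball X = closure (aconv (norming_face f)).
Proof.
move=> f1 fS; apply/seteqP; split=> x; last first.
  move=> /closure_nrmP clx; apply/nrm_le1P/ler_addgt0Pr => e e0.
  have [a Aa xa] := clx e e0; have a1 : nrm a <= 1.
    apply: (aconv_ball _ Aa) => y [+ _].
    rewrite /unit_sphere /= nrmE -(@embed1 _ k) => /(congr1 re).
    by rewrite !embed_re => ->.
  by have := nrmD (x - a) a; rewrite subrK; lra.
move=> /nrm_le1P x1; apply/closure_nrmP => d d0.
pose s := Num.min 1 (d / 16).
have s0 : 0 < s by rewrite lt_min ltr01 divr_gt0.
have s1 : s <= 1 by rewrite ge_min lexx.
have sd : s <= d / 16 by rewrite ge_min lexx orbT.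
have [|a Aa xa] := fS (s ^+ 2) _ x (d / 2) x1 ltac:(lra).
  by rewrite exprn_gt0.
have [b Fb ab] : [set a | exists2 b,
    aconv (norming_face f) b & nrm (a - b) <= 8 * s] a.
  move: a Aa {xa}; apply: aconv_min.
    move=> y z t t01 [b Fb yb] [c Fc zc].
    exists (embed t *: b + embed (1 - t) *: c); first exact: aconv_rconvex.
    case/andP: t01 => t0 t1; have t1' : 0 <= 1 - t by lra.
    rewrite opprD addrACA -!scalerBr; apply: (le_trans (nrmD _ _)).
    rewrite !nrmZ !nrm_embed//.
    by have := ler_wpM2l t0 yb; have := ler_wpM2l t1' zc; lra.
  move=> w y w1 Sy; have [|z Fz yz] := slice_near_face f1 fS _ Sy.
    by rewrite s0.
  exists (w *: z); first exact: aconv_unit.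
  by rewrite -scalerBr nrm_unit// nrmB.
by exists b => //; have := nrm_triangle a x b; lra.
Qed.

End Faces.

(** * Consequences of lushness *)

Section Lushness.
Context {R : realType} {k : scalar_kind}.
Local Notation K := (scalar_field R k).
Local Notation re := (@scalar_re R k).

(** [b] drops the rotations from the combination [a], independently of [f]. Replacing the generators
    outside the slice by [0] costs at most their weight, while each contributes at least [e] times
    its weight to [1 - re (f b)], as in Markov's inequality. *)
Lemma slices_of_aconv (X : normedModType K) (F : set X) (a : X) (e : R) :
  F `<=` [set x | nrm x <= 1] -> 0 < e -> aconv F a ->
  exists2 b, Defs.conv F b & forall f : dual X,
    nrm f <= 1 -> slice f e !=set0 -> exists2 a',
    aconv (slice f e) a' & e * nrm (a - a') <= 1 - re (f b).
Proof.
move=> F1 e0; move: a.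
apply: (@aconv_min _ _ _ _ [set a | exists2 b, Defs.conv F b &
    forall f : dual X, nrm f <= 1 -> slice f e !=set0 ->
    exists2 a', aconv (slice f e) a' & e * nrm (a - a') <= 1 - re (f b)]).
  move=> x y t t01 [b Fb xb] [c Fc yc].
  exists (embed t *: b + embed (1 - t) *: c); first exact: conv_rconvex.
  move=> f f1 f0; have [x' Sx' xx'] := xb f f1 f0.
  have [y' Sy' yy'] := yc f f1 f0.
  exists (embed t *: x' + embed (1 - t) *: y'); first exact: aconv_rconvex.
  case/andP: t01 => t0 t1; have t1' : 0 <= 1 - t by lra.
  rewrite opprD addrACA -!scalerBr dualD !dualZ reD !reZ.
  apply: (@le_trans _ _ (e * (t * nrm (x - x') + (1 - t) * nrm (y - y')))).
    rewrite ler_wpM2l ?(ltW e0)//; apply: (le_trans (nrmD _ _)).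
    by rewrite !nrmZ !nrm_embed.
  by have := ler_wpM2l t0 xx'; have := ler_wpM2l t1' yy'; lra.
move=> w x w1 Fx; exists x; first exact: sub_conv.
move=> f f1 f0; have x1 := F1 _ Fx.
have [fx|fx] := ltP (1 - e) (re (f x)).
  exists (w *: x); first exact: aconv_unit.
  rewrite subrr nrm0 mulr0; have := nrm_dual_le1 x f1; rewrite /= in x1; lra.
exists 0; first exact: aconv0.
rewrite subr0 nrm_unit//; have := ler_wpM2l (ltW e0) x1; lra.
Qed.

Variables (X Y : normedModType K) (G : bounded_op X Y).
Hypothesis lushG : lush G.
Implicit Types (f : dual Y) (x : X) (y : Y) (e d r : R).

Lemma lush_nrm : nrm G = 1.
Proof. by case: lushG => G1 _; rewrite /nrm G1 -(@embed1 _ k) embed_re. Qed.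

Lemma lush_nrm_le x : nrm (G x) <= nrm x.
Proof. by have := op_nrm_ub G x; rewrite lush_nrm mul1r. Qed.

Lemma adjointE f x : adjoint G f x = f (G x).
Proof. by []. Qed.

Lemma adjoint_nrm_le1 f : nrm f <= 1 -> nrm (adjoint G f) <= 1.
Proof.
move=> f1; apply: nrm_dual_le => x x1; rewrite adjointE.
by apply: le_trans (nrm_dual_le1 _ f1) _; apply: le_trans (lush_nrm_le _) x1.
Qed.

Lemma lush_unit_vector : exists y : Y, nrm y = 1.
Proof.
suff [y y0] : exists y : Y, y != 0.
  exists (embed (nrm y)^-1 *: y).
  have ny0 : 0 < nrm y by rewrite -(@embed_lt _ k) -nrmE embed0 normr_gt0.
  by rewrite nrmZ nrm_embed ?invr_ge0 ?(ltW ny0)// mulVf// gt_eqF.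
apply: contrapT => Y0; have := lush_nrm.
have -> : G = 0.
  apply/val_inj/funext => x /=; apply/eqP; apply: contrapT => /negP Gx.
  by apply: Y0; exists (G x).
by rewrite nrm0 => /eqP; rewrite eq_sym oner_eq0.
Qed.

Lemma lush_approx x e y : nrm x <= 1 -> 0 < e -> nrm y = 1 ->
  exists F (a : X), [/\ F `<=` [set x | nrm x <= 1],
    forall b, Defs.conv F b -> 2 - e < nrm (G b + y),
    aconv F a & nrm (x - a) < e].
Proof.
move=> x1 e0 y1; case: lushG => _ /(_ x (embed e) y).
rewrite -(@embed0 R k) embed_lt => -[||| F [F1 FG [d xd de]]] //.
- exact/nrm_le1P.
- by rewrite /unit_sphere /= nrmE y1 embed1.
have [a Fa xa] : exists2 a, aconv F a & nrm (x - a) < e.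
  apply: contrapT => nxa; have : embed e <= d.
    apply: xd.2 => _ [a Fa <-]; rewrite nrmE embed_le leNgt; apply/negP => xa.
    by apply: nxa; exists a.
  by move=> /le_lt_trans/(_ de); rewrite ltxx.
exists F, a; split=> // [z /F1/nrm_le1P//|b /FG[_]].
rewrite nrmE -(@embed_lt _ k); apply: le_lt_trans.
by rewrite embedB (_ : (2 : R) = 1 + 1)// embedD embed1.
Qed.

(** One [r] serves all [f], so the condition survives small moves of [y] at the price of a smaller
    [r], as the Baire construction requires. *)
Definition good_slice x e y r := forall f, nrm f <= 1 -> nrm y - r < re (f y) ->
  exists2 a, aconv (slice (adjoint G f) e) a & nrm (x - a) < 2 * e.

(* The perturbation is [y + tau * G b], where [b] is the convex combination
   underlying an element of [aconv F] near [x]: functionals almost attaining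
   its norm are almost [1] at [G b], hence at most of the [G x_i]. *)
Lemma good_slice_dense x e y d : nrm x <= 1 -> 0 < e <= 1 -> 0 < d ->
  exists y' r, [/\ 0 < r, nrm (y' - y) <= d & good_slice x e y' r].
Proof.
move=> x1 /andP[e0 e1] d0.
(* Normalizing needs a nonzero vector, so [y = 0] is first moved by [d / 2]. *)
have [y0 y00 y0y] : exists2 y0, 0 < nrm y0 & nrm (y0 - y) <= d / 2.
  have [->|yn0] := eqVneq y 0; last first.
    exists y; last by rewrite subrr nrm0; lra.
    by rewrite -(@embed_lt _ k) -nrmE embed0 normr_gt0.
  have [v v1] := lush_unit_vector; exists (embed (d / 2) *: v).
    by rewrite nrmZ v1 nrm_embed; lra.
  by rewrite subr0 nrmZ v1 nrm_embed; lra.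
pose L := nrm y0; have L0 : 0 < L by [].
pose u := embed L^-1 *: y0.
have u1 : nrm u = 1.
  by rewrite /u nrmZ nrm_embed ?invr_ge0 ?(ltW L0)// mulVf// gt_eqF.
pose t := Num.min 1 (d / (2 * L)).
have t0 : 0 < t by rewrite lt_min ltr01 divr_gt0// mulr_gt0.
have t1 : t <= 1 by rewrite ge_min lexx.
have tL : L * t <= d / 2.
  have : t <= d / (2 * L) by rewrite ge_min lexx orbT.
  by rewrite ler_pdivlMr ?mulr_gt0//; lra.
(* Chosen so that [re (f v) > nrm v - e'] forces [1 - re (f (G b)) < 2 * e' / t = e ^+ 2], after
   which [slices_of_aconv] gives a distance below [e]. *)
pose e' := t * e ^+ 2 / 2.
have e'0 : 0 < e' by rewrite /e' divr_gt0// mulr_gt0// exprn_gt0.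
have e'e : e' <= e.
  have : t * e ^+ 2 <= 1 * e.
    by rewrite ler_pM ?(ltW t0) ?exprn_ge0 ?(ltW e0)// expr2 ler_piMl// ltW.
  by rewrite /e'; lra.
have [F [a [F1 FG Fa xa]]] := lush_approx x1 e'0 u1.
have [b Fb bP] := slices_of_aconv F1 e0 Fa.
have b1 : nrm b <= 1 by apply: (conv_min _ F1) Fb; exact: nrm_rconvex.
have Gb1 : nrm (G b) <= 1 by apply: le_trans (lush_nrm_le _) b1.
pose v := u + embed t *: G b.
have v_gt : 1 + t - e' < nrm v.
  have -> : v = (G b + u) - embed (1 - t) *: G b.
    rewrite /v embedB embed1 scalerBl scale1r opprB [G b + u]addrC -addrA.
    by rewrite [G b + (_ - _)]addrCA subrr addr0.
  have := nrmD ((G b + u) - embed (1 - t) *: G b) (embed (1 - t) *: G b).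
  rewrite subrK nrmZ nrm_embed; last by lra.
  have := FG _ Fb; have := @ler_wpM2l _ (1 - t) ltac:(lra) _ _ Gb1; lra.
have y0E : y0 = embed L *: u.
  by rewrite /u scalerA -embedM divff ?embed1 ?scale1r// gt_eqF.
exists (embed L *: v), (L * e'); split; first by rewrite mulr_gt0.
  have := nrm_triangle y0 (embed L *: v) y.
  rewrite {1}y0E -scalerBr /v [u + _]addrC addrK.
  rewrite !nrmZ !nrm_embed ?(ltW L0) ?(ltW t0)//.
  have : L * (t * nrm (G b)) <= L * t.
    by rewrite mulrA ler_piMr// mulr_ge0 ?(ltW L0) ?(ltW t0).
  by lra.
move=> f f1; rewrite nrmZ nrm_embed ?(ltW L0)// dualZ reZ -mulrBr ltr_pM2l//.
rewrite dualD dualZ reD reZ => fv.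
have fu := nrm_dual_le1 u f1; rewrite u1 in fu.
have fGb : 1 - re (f (G b)) < e ^+ 2.
  rewrite -(ltr_pM2l t0); move: fv v_gt; rewrite /e'; lra.
have ee : e ^+ 2 <= e by rewrite expr2 ler_piMl// ltW.
have [|a' Sa' aa'] := bP (adjoint G f) (adjoint_nrm_le1 f1).
  by exists b; split=> //; rewrite adjointE; lra.
exists a' => //; have {}aa' : nrm (a - a') < e.
  by rewrite -(ltr_pM2l e0); move: aa'; rewrite adjointE -expr2; lra.
by have := nrm_triangle a x a'; lra.
Qed.

End Lushness.

(** * The Baire argument in the target space *)

Section GenericNorming.
Context {R : realType} {k : scalar_kind}.
Local Notation K := (scalar_field R k).
Local Notation re := (@scalar_re R k).

Lemma generic_norming (X : normedModType K) (Y : completeNormedModType K)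
    (G : bounded_op X Y) (x : nat -> X) (e : nat -> R) (y : Y) (d : R) :
  lush G -> (forall n, nrm (x n) <= 1) -> (forall n, 0 < e n <= 1) -> 0 < d ->
  exists2 l : Y, nrm (l - y) <= d & forall f : dual Y, nrm f <= 1 ->
    re (f l) = nrm l -> forall n,
    exists2 a, aconv (slice (adjoint G f) (e n)) a & nrm (x n - a) < 2 * e n.
Proof.
move=> lushG x1 e01 d0.
(* Stage [m.+1] handles index [m]; stage [0] only records the start. A functional norming the limit
   loses at most [r] twice at [z], hence lies in the slice of width [3 * r]. *)
pose P n (z : Y) r := 0 < r /\
  (if n is m.+1 then good_slice G (x m) (e m) z (3 * r) else True).
have [||l [ly lP]] := @approx_limit _ _ Y P _ y d.
- move=> n z r [r0 _]; split=> //.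
  have r20 : 0 < r / 2 by lra.
  have [z' [s [s0 zz' gz']]] := good_slice_dense lushG z (x1 n) (e01 n) r20.
  exists z', (Num.min (r / 2) (s / 3)); split=> //; last by rewrite ge_min lexx.
  split; first by rewrite lt_min r20; lra.
  have s3 : Num.min (r / 2) (s / 3) <= s / 3 by rewrite ge_min lexx orbT.
  by move=> f f1 fz; apply: gz' => //; lra.
- by [].
exists l => // f f1 fl n; have [z [s [[s0 Pz] lz _]]] := lP n.+1.
apply: Pz => //; have := nrm_dual_le1 (l - z) f1; rewrite dualB reD reN.
by have := nrmD (z - l) l; rewrite subrK nrmB fl; lra.
Qed.

End GenericNorming.

(** * The weak-star topology on extreme functionals *)

Section ExtremeFunctionals.
Context {R : realType} {k : scalar_kind}.
Local Notation K := (scalar_field R k).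
Local Notation re := (@scalar_re R k).
Variable Y : normedModType K.
Implicit Types (f g : dual Y) (y : Y) (e : R).

Definition re_part f : realify Y -> R := fun y => re (f y).

Lemma re_part_inj f g : re_part f = re_part g -> f = g.
Proof.
move=> fg; apply/val_inj/funext => y; rewrite -[LHS]/(f y) -[RHS]/(g y).
have E z : re (f z) = re (g z) by have := congr1 (@^~ z) fg.
by rewrite (scalar_imunit (f y)) (scalar_imunit (g y)) -!dualZ !E.
Qed.

Lemma re_part_of (g : realify Y -> R) : scalar g ->
  (forall y, g y <= nrm (y : Y)) -> exists2 f, nrm f <= 1 & re_part f = g.
Proof.
move=> lg g1; have [|f fE] := functional_of_re ler01 lg.
  by move=> y; rewrite mul1r.
exists f; last exact/funext.
by apply: nrm_dual_le => y y1; rewrite fE; exact: le_trans (g1 y) y1.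
Qed.

(** Taking real parts is a bijection from the dual ball onto the linear functionals below the norm,
    compatible with real weights; [0 < t < 1] makes [t] real. *)
Lemma extreme_pointsP f : extreme_points (unit_ball (dual Y)) f <->
  extremal (fun y : realify Y => nrm (y : Y)) (re_part f).
Proof.
split=> [[/nrm_le1P f1 fext]|[_ f1 fext]].
  split; [exact: re_scalar|by move=> y; exact: nrm_dual_le1|].
  move=> g1 g2 t l1 l2 le1 le2 /andP[t0 t1] fE.
  have [h1 h11 h1E] := re_part_of l1 le1.
  have [h2 h21 h2E] := re_part_of l2 le2.
  have [||||hf1 hf2] := fext h1 h2 (embed t).
  - exact/nrm_le1P.
  - exact/nrm_le1P.
  - by rewrite -(@embed0 R k) -(@embed1 R k) !embed_lt t0.
  - apply: re_part_inj; apply/funext => y.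
    rewrite fE -h1E -h2E -(@embed1 R k) -embedB.
    rewrite /re_part -[RHS]/(re (embed t * h1 y + embed (1 - t) * h2 y)).
    by rewrite reD !reZ.
  - by rewrite -h1E -h2E hf1 hf2.
split.
  by apply/nrm_le1P/nrm_dual_le => y y1; apply: le_trans (f1 y) y1.
move=> g h t /nrm_le1P g1 /nrm_le1P h1 /andP[t0 t1] fE.
have tE := ge0_embed (ltW t0).
have [||||||gE hE] := fext (re_part g) (re_part h) (re t).
- exact: re_scalar.
- exact: re_scalar.
- by move=> y; exact: nrm_dual_le1.
- by move=> y; exact: nrm_dual_le1.
- by rewrite -!(@embed_lt _ k) embed0 embed1 -tE t0.
- move=> y; rewrite /re_part fE {1 2}tE -(@embed1 R k) -embedB.
  rewrite -[X in re X]/(embed (re t) * g y + embed (1 - re t) * h y).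
  by rewrite reD !reZ.
by split; exact: re_part_inj.
Qed.

Lemma ext_dual_extremal (f : ext_dual Y) :
  extremal (fun y : realify Y => nrm (y : Y)) (re_part (set_val f)).
Proof. by apply/extreme_pointsP; have := set_valP f. Qed.

Lemma ext_dual_nrm (f : ext_dual Y) : nrm (set_val f : dual Y) <= 1.
Proof. by have [/nrm_le1P] := set_valP f. Qed.

Lemma eval_continuous y :
  continuous (fun f : ext_dual Y => (set_val f : dual Y) y : K^o).
Proof.
pose ev (f : {ptws Y -> K^o}) := f y.
have evc : continuous ev by exact: (@proj_continuous Y (fun=> K^o) y).
move=> f; apply: (@continuous_comp _ _ _
    (fun f : ext_dual Y =>
       ((set_val f : dual Y) : Y -> K^o) : {ptws Y -> K^o}) ev);
  last exact: evc.
apply: (@continuous_comp _ _ _ (set_val : ext_dual Y -> weak_star Y)).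
  exact: initial_continuous.
exact: initial_continuous.
Qed.

(** Matches the one-sided form of [extremal_slice]: multiplying test vectors by [1], [-1], [i] and
    [-i] turns upper bounds on real parts into a bound on the modulus. *)
Lemma weak_star_nbhs (f : ext_dual Y) (W : set (ext_dual Y)) : nbhs f W ->
  exists (s : seq Y) (e : R), 0 < e /\ forall g : ext_dual Y,
    (forall y, y \in s ->
       re ((set_val g : dual Y) y) < re ((set_val f : dual Y) y) + e) ->
    W g.
Proof.
move=> [_ [[B [C oC <-] <-] /= Bf] BW].
(* The filter of basic pointwise neighbourhoods of [f]; its convergence to [f] puts the open set [C]
   in it. *)
pose F : set_system {ptws Y -> K^o} := [set A | exists (s : seq Y) (e : R),
  0 < e /\ forall g : Y -> K^o,
    (forall y, y \in s -> nrm (g y - (set_val f : dual Y) y : K^o) < e) ->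
    A g].
have FF : Filter F.
  split; first by exists [::], 1.
  - move=> A A' [s [e [e0 sA]]] [s' [e' [e'0 s'A']]].
    exists (s ++ s'), (Num.min e e'); split; first by rewrite lt_min e0.
    move=> g gs; split.
      apply: sA => y ys; have := gs y; rewrite mem_cat ys => /(_ isT).
      by rewrite lt_min => /andP[].
    apply: s'A' => y ys; have := gs y; rewrite mem_cat ys orbT => /(_ isT).
    by rewrite lt_min => /andP[].
  - move=> A A' AA' [s [e [e0 sA]]]; exists s, e; split=> // g /sA; exact: AA'.
have : F --> (((set_val f : dual Y) : Y -> K^o) : {ptws Y -> K^o}).
  apply/pointwise_cvgP => y; apply/cvgrPdist_lt => e e0.
  exists [:: y], (re e); split.
    by rewrite -(@embed_lt _ k) embed0 -ge0_embed// ltW.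
  move=> g /(_ y (mem_head _ _)); rewrite nrmB.
  by rewrite -(@embed_lt _ k) -nrmE -ge0_embed// ltW.
move=> /(_ C)[|s [e [e0 sC]]]; first by apply: open_nbhs_nbhs; split.
exists [seq w *: y | w <- [:: 1; -1; imunit; - imunit], y <- s], (e / 2).
split=> [|g gs]; first by lra.
apply: BW; apply: sC => y ys; apply: le_lt_trans (nrm_le_re _) _.
set z := _ - _.
have wz w : w \in [:: 1; -1; imunit; - imunit] -> re (w * z) < e / 2.
  move=> ws; have := gs _ (allpairs_f *:%R ws ys).
  by rewrite /z !dualZ mulrBr reD reN; lra.
have abs_lt r : r < e / 2 -> - r < e / 2 -> `|r| < e / 2.
  by rewrite ltr_norml => ? ?; lra.
have : `|re z| < e / 2.
  apply: abs_lt.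
    by have := wz 1; rewrite mul1r; apply; rewrite !inE eqxx.
  by have := wz (-1); rewrite mulN1r reN; apply; rewrite !inE eqxx ?orbT.
have : `|re (imunit * z)| < e / 2.
  apply: abs_lt.
    by have := wz imunit; apply; rewrite !inE eqxx ?orbT.
  by have := wz (- imunit); rewrite mulNr reN; apply; rewrite !inE eqxx ?orbT.
by lra.
Qed.

End ExtremeFunctionals.

(** * Countable reduction, openness and density *)

Section Main.
Context {R : realType} {k : scalar_kind}.
Local Notation K := (scalar_field R k).
Local Notation re := (@scalar_re R k).

Lemma separable_sequence (X : normedModType K) : separable_space X ->
  exists u : nat -> X, dense (range u).
Proof.
move=> [D /countable_injP[f finj] dD].
(* Codes that are not attained give the default [0]; enlarging the range preserves density. *)
exists (fun n => xget 0 [set d | D d /\ f d = n]) => O O0 oO.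
have [d [Od Dd]] := dD O O0 oO; exists d; split=> //; exists (f d) => //.
case: xgetP => [d' _ [Dd' ff]|/(_ d)]; last by case.
by apply: finj; rewrite ?inE.
Qed.

(** For fixed [a], membership persists near [f]: the strict inequality at a generator does, and
    [aconv_min] passes this on to convex combinations. *)
Lemma aconv_slice_open (X Y : normedModType K) (G : bounded_op X Y) x e d :
  open [set f : ext_dual Y | exists2 a,
    aconv (slice (adjoint G (set_val f)) e) a & nrm (x - a) < d].
Proof.
rewrite openE => f [a Fa xa]; rewrite /interior /=.
suff : \forall g \near f,
    aconv (slice (adjoint G (set_val (g : ext_dual Y))) e) a.
  by apply: filterS => g Ga; exists a.
move: a Fa {xa}; apply: aconv_min => [y z t t01 Ny Nz|w y w1 [y1 fy]].
  by near=> g; apply: aconv_rconvex => //; near: g.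
have : \forall g \near f, slice (adjoint G (set_val (g : ext_dual Y))) e y.
  have := @eval_continuous _ _ _ (G y) f => /cvgrPdist_lt.
  move=> /(_ (embed (re ((set_val f : dual Y) (G y)) - (1 - e)))).
  rewrite -(@embed0 R k) embed_lt subr_gt0 => /(_ fy); apply: filterS => g.
  rewrite nrmE embed_lt => fg; split=> //; rewrite /adjoint /=.
  have := re_le_norm ((set_val f : dual Y) (G y) - (set_val g : dual Y) (G y)).
  rewrite -[leRHS]/(nrm (_ - _ : K^o)).
  by rewrite reD reN; move: fg; lra.
by apply: filterS => g; exact: aconv_unit.
Unshelve. all: by end_near. Qed.

Lemma aconv_slice_le (X : normedModType K) (f : dual X) e e' : e' <= e ->
  aconv (slice f e') `<=` aconv (slice f e).
Proof.
move=> ee; apply: aconv_min; first exact: aconv_rconvex.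
by move=> w x w1 [x1 fx]; apply: aconv_unit => //; split=> //; lra.
Qed.

(* [n] codes a pair [(i, m)], standing for the point [u i] and the width
   [1 / (m + 1)]. *)
Definition net_point (X : normedModType K) (u : nat -> X) (n : nat) : X :=
  let x := u (odflt (0, 0)%N (unpickle n)).1 in if nrm x <= 1 then x else 0.

Definition net_width (n : nat) : R := (odflt (0, 0)%N (unpickle n)).2.+1%:R^-1.

Lemma net_point_le1 (X : normedModType K) (u : nat -> X) n :
  nrm (net_point u n) <= 1.
Proof. by rewrite /net_point; case: ifP => // _; rewrite nrm0. Qed.

Lemma net_width01 n : 0 < net_width n <= 1.
Proof. by rewrite invr_gt0 ltr0Sn invf_le1 ?ltr0Sn// ler1n. Qed.

Lemma slice_dense_net (X : normedModType K) (u : nat -> X) (f : dual X) :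
  dense (range u) ->
  (forall n, exists2 a, aconv (slice f (net_width n)) a &
     nrm (net_point u n - a) < 2 * net_width n) ->
  forall e, 0 < e -> slice_dense f e.
Proof.
move=> du fnet e e0 x d x1 d0.
pose m := Num.bound (Num.max e^-1 (8 / d)).
have m_gt : Num.max e^-1 (8 / d) < m%:R.
  by apply: archi_boundP; rewrite le_max invr_ge0 (ltW e0).
have w0 : (0 : R) < m.+1%:R by rewrite ltr0Sn.
have mm : (m%:R : R) < m.+1%:R by rewrite ltr_nat.
have we : (m.+1%:R : R)^-1 <= e.
  rewrite -[e]invrK lef_pV2 ?posrE ?invr_gt0//; apply/ltW/(lt_trans _ mm).
  by apply: le_lt_trans m_gt; rewrite le_max lexx.
have wd : 2 * (m.+1%:R : R)^-1 < d / 4.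
  have : 8 / d < m.+1%:R.
    apply: (lt_trans _ mm); apply: le_lt_trans m_gt.
    by rewrite le_max lexx orbT.
  rewrite ltr_pdivrMr// => ?; rewrite -(ltr_pM2r w0) -mulrA mulVf ?gt_eqF//.
  by lra.
pose h := Num.min 1 (d / 4).
have h0 : 0 < h by rewrite lt_min ltr01 divr_gt0.
have h1 : h <= 1 by rewrite ge_min lexx.
have hd : h <= d / 4 by rewrite ge_min lexx orbT.
(* Shrinking leaves room for a nearby [u i] inside the ball, so that [net_point] returns it rather
   than the default [0]. *)
pose x' := embed (1 - h) *: x.
have x'1 : nrm x' <= 1 - h.
  rewrite nrmZ nrm_embed; last by lra.
  by have := @ler_wpM2l _ (1 - h) ltac:(lra) _ _ x1; lra.
have xx' : nrm (x - x') <= h.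
  rewrite -[X in X - _]scale1r -(@embed1 _ k) -scalerBl -embedB nrmZ.
  rewrite nrm_embed; last by lra.
  by have := ler_wpM2l (ltW h0) x1; lra.
have [i ix] : exists i, nrm (x' - u i) < h.
  have [|_ [/[swap] -[i _ <-] x'u]] := du (ball x' (embed h)) _ (ball_open _ _).
    by exists x'; apply: ballxx; rewrite -(@embed0 R k) embed_lt.
  by exists i; move: x'u; rewrite -ball_normE /= nrmE embed_lt.
have ui1 : nrm (u i) <= 1.
  have := nrmD (u i - x') x'; rewrite subrK nrmB; lra.
have [a Fa ua] := fnet (pickle (i, m)).
move: Fa ua; rewrite /net_point /net_width pickleK /= ui1 => Fa ua.
exists a; first exact: aconv_slice_le Fa.
have {}ua := lt_trans ua wd.
by have := nrm_triangle x' x (u i); have := nrm_triangle (u i) x a; lra.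
Qed.

End Main.

Theorem theorem3p31 (R : realType) (k : scalar_kind)
  (X Y : completeNormedModType (scalar_field R k)) (G : bounded_op X Y)
  (separableX : separable_space X) (lushG : lush G) :
  (let Omega : set (ext_dual Y) :=
     [set y | spear (dual X) (adjoint G (set_val y))] in
   dense Omega /\ Gdelta Omega) /\
  (exists Omega : set (ext_dual Y),
     [/\ dense Omega, Gdelta Omega &
       forall y : ext_dual Y, Omega y ->
         unit_ball X =
         closure (aconv [set x : X | unit_sphere X x /\
           scalar_re ((set_val y : dual Y) (G x)) = 1])]).
Proof.
have [u du] := separable_sequence separableX.
have nG (f : ext_dual Y) : nrm (adjoint G (set_val f) : dual X) <= 1.
  by apply: adjoint_nrm_le1 => //; exact: ext_dual_nrm.
pose Omega : set (ext_dual Y) :=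
  [set y | spear (dual X) (adjoint G (set_val y))].
pose O n : set (ext_dual Y) := [set f | exists2 a,
  aconv (slice (adjoint G (set_val f)) (net_width n)) a &
  nrm (net_point u n - a) < 2 * net_width n].
have OE : Omega = \bigcap_n O n.
  apply/seteqP; split=> f.
    move=> spf n _; have /andP[w0 _] := @net_width01 R n.
    by apply: spear_slice => //; [exact: net_point_le1|rewrite mulr_gt0].
  move=> Of; apply: (slice_spear (nG f)); apply: (slice_dense_net du) => n.
  exact: (Of n I).
have dO : dense Omega.
  move=> W [p Wp] oW.
  have [s [e [e0 sW]]] := weak_star_nbhs (open_nbhs_nbhs (conj oW Wp)).
  have [z [a [az zs]]] :=
    extremal_slice (s : seq (realify Y)) (@nrm_sublinear _ _ Y)
      (ext_dual_extremal p) e0.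
  (* A functional norming [l] satisfies [re (f z) >= nrm z - 2 * d]; the remaining third keeps it in
     the slice. *)
  pose d := (re_part (set_val p) z - a) / 3.
  have d0 : 0 < d by rewrite /d; lra.
  have [l lz lP] := generic_norming (z : Y) lushG (net_point_le1 u)
    (@net_width01 R) d0.
  (* An extreme point of the face of functionals norming [l] meets all the countably many
     conditions, hence lies in [Omega]. *)
  have [g extg gl] := exists_extremal (l : realify Y) (@nrm_sublinear _ _ Y).
  have [lg gN _] := extg.
  have [f f1 fE] := re_part_of lg gN; rewrite -fE in extg gl.
  have /extreme_pointsP extf := extg.
  pose f' : ext_dual Y := exist _ (f : weak_star Y) (mem_set extf).
  exists f'; split; last by rewrite OE => n _; exact: lP.
  apply: sW => y ys; apply: (zs (re_part f)) => //.
  - exact: re_scalar.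
  - by move=> x; exact: nrm_dual_le1.
  - have lz' : re_part f l - re_part f z <= d.
      apply: le_trans lz; apply: le_trans (nrm_dual_le1 (l - (z : Y)) f1).
      by rewrite dualB reD reN.
    have pz : re_part (set_val p) z <= nrm (z : Y).
      exact: nrm_dual_le1 (ext_dual_nrm p).
    have zl : nrm (z : Y) <= d + re_part f l.
      rewrite gl -[z in leLHS](subrK (l : Y)).
      by apply: le_trans (nrmD _ _) _; rewrite lerD2r nrmB.
    by move: lz' pz zl; rewrite /d; lra.
have GO : Gdelta Omega by exists O => // n; exact: aconv_slice_open.
split=> //; exists Omega; split=> // y spy.
by apply: (ball_closure_face (nG y)) => e e0; exact: spear_slice.
Qed.
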